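(* Let $g_1,g_2\in\mathcal{S}(\mathbb{Z}^n)$, $\beta\in L^\infty(\mathbb{T}^n)$, and let $\varsigma(m,w)=\beta(w)$ for $(m,w)\in\mathbb{Z}^n\times\mathbb{T}^n$. Then for all $f,h\in\ell^2(\mathbb{Z}^n)$, $$\langle\mathfrak{L}^{g_1,g_2}_\varsigma f,h\rangle_{\ell^2(\mathbb{Z}^n)}=\langle T_\mu f,h\rangle_{\ell^2(\mathbb{Z}^n)},$$ where $T_\mu$ is the Fourier multiplier with symbol $\mu$ given by $$\mu(\xi)=\int_{\mathbb{T}^n}\beta(w)\,\overline{(M_wg_1)^\wedge(\xi)}\,(M_wg_2)^\wedge(\xi)\,dw,\qquad\xi\in\mathbb{T}^n.$$
   Context: $\mathbb{T}^n$ is the torus with normalized Haar measure $dw$; $\mathcal{S}(\mathbb{Z}^n)$ is the space of rapidly decreasing functions on $\mathbb{Z}^n$. $\hat f(w)=f^\wedge(w)=\sum_{k\in\mathbb{Z}^n}e^{-2\pi i k\cdot w}f(k)$ is the Fourier transform on $\mathbb{Z}^n$ (a unitary map $\ell^2(\mathbb{Z}^n)\to L^2(\mathbb{T}^n)$). The Fourier multiplier $T_\mu$ is defined by $(T_\mu f)^\wedge=\mu\hat f$. For $m\in\mathbb{Z}^n$ and $w\in\mathbb{T}^n$: $T_mf(k)=f(k-m)$, $M_wf(k)=e^{2\pi i w\cdot k}f(k)$, $V_gf(m,w)=\langle f,M_wT_mg\rangle_{\ell^2(\mathbb{Z}^n)}=\sum_{k\in\mathbb{Z}^n}f(k)\overline{g(k-m)}e^{-2\pi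 i w\cdot k}$. The localization operator with symbol $\varsigma$ and windows $g_1,g_2$ is given by $$\langle\mathfrak{L}^{g_1,g_2}_\varsigma f,h\rangle_{\ell^2(\mathbb{Z}^n)}=\sum_{m\in\mathbb{Z}^n}\int_{\mathbb{T}^n}\varsigma(m,w)\,V_{g_1}f(m,w)\,\overline{V_{g_2}h(m,w)}\,dw,\qquad f,h\in\ell^2(\mathbb{Z}^n).$$ *)

(* Defs.v *)
From HB Require Import structures.
From mathcomp Require Import all_boot all_order all_algebra.
From mathcomp Require Import finmap.
From mathcomp Require Import all_classical all_reals all_analysis.
From mathcomp.analysis.showcase Require summability.
From mathcomp Require Import complex.

Set Implicit Arguments.
Unset Strict Implicit.
Unset Printing Implicit Defensive.

Import Order.TTheory GRing.Theory Num.Theory.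
Import numFieldNormedType.Exports.

Local Open Scope classical_set_scope.
Local Open Scope ring_scope.
Local Open Scope complex_scope.

Notation cabs := ComplexField.Normc.normc.

(* A point of the torus T^n = R^n / Z^n is given by real representatives of its
   coordinates, and a function on T^n by a function of these representatives of
   which only the values on the fundamental cube matter: all integrals, norms
   and "almost everywhere" below refer to the probability measure [haar R n],
   the n-fold product of the uniform law on [0, 1], which is carried by that
   cube. *)
Notation Zn n := 'rV[int]_n.
Notation torus R n := (n.-tuple R).

Section Haar.
Context {R : realType}.

Definition cons_torus n (p : R * torus R n) : torus R n.+1 :=
  [the n.+1.-tuple R of p.1 :: p.2].

Lemma measurable_cons_torus n :
  measurable_fun [set: (R * torus R n)%type] (@cons_torus n).
Proof.
exact: (measurable_cons (@measurable_fst _ _ _ _) (@measurable_snd _ _ _ _)).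
Qed.

Section HaarS.
Variables (n : nat) (P : probability (torus R n) R).

Definition haarS : set (torus R n.+1) -> \bar R :=
  pushforward (product_measure1 (uniform_prob (@ltr01 R)) P) (@cons_torus n).

Let haarS0 : haarS set0 = 0%E.
Proof. by rewrite /haarS /pushforward preimage_set0 measure0. Qed.

Let haarS_ge0 A : (0 <= haarS A)%E.
Proof. by rewrite /haarS /pushforward measure_ge0. Qed.

Let haarS_sigma_additive : semi_sigma_additive haarS.
Proof.
have mf := @measurable_cons_torus n.
exact: (@measure_semi_sigma_additive _ _ _ (pushforward
  (uniform_prob (@ltr01 R) \x P)%E (@cons_torus n))).
Qed.

HB.instance Definition _ :=
  isMeasure.Build _ _ _ haarS haarS0 haarS_ge0 haarS_sigma_additive.

Let haarS_setT : haarS [set: _] = 1%E.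
Proof. by rewrite /haarS /pushforward preimage_setT; exact: probability_setT. Qed.

HB.instance Definition _ := Measure_isProbability.Build _ _ _ haarS haarS_setT.
End HaarS.

End Haar.

(* Normalized Haar measure dw on T^n. *)
Fixpoint haar (R : realType) (n : nat) : probability (torus R n) R :=
  if n is n'.+1 then haarS (haar R n') else \d_[tuple].

Section Definitions.
Context {R : realType} {n : nat}.
Implicit Types (f g h u : Zn n -> R[i]) (F : torus R n -> R[i]).
Implicit Types (m k : Zn n) (w xi : torus R n).

(* Unconditional sum over Z^n (limit along the finite subsets) and Lebesgue
   integral over T^n, taken componentwise. *)
Definition csum f : R[i] :=
  summability.sum (fun k => complex.Re (f k))
    +i* summability.sum (fun k => complex.Im (f k)).

Definition cint F : R[i] :=
  Rintegral (haar R n) setT (fun w => complex.Re (F w))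
    +i* Rintegral (haar R n) setT (fun w => complex.Im (F w)).

Definition cmeasurable F : Prop :=
  measurable_fun setT (fun w => complex.Re (F w)) /\
  measurable_fun setT (fun w => complex.Im (F w)).

Definition normLp (p : \bar R) F : \bar R :=
  Lnorm (haar R n) p (fun w => (cabs (F w))%:E).

(* F represents an element of L^p(T^n). *)
Definition in_Lp (p : \bar R) F : Prop :=
  cmeasurable F /\ (normLp p F < +oo)%E.

Definition in_l2 f : Prop :=
  (\esum_(k in setT) ((cabs (f k)) ^+ 2)%:E < +oo)%E.

Definition inner f h : R[i] := csum (fun k => f k * (h k)^*).

Definition enorm k : R := Num.sqrt (\sum_i ((k ord0 i)%:~R) ^+ 2).

(* The space S(Z^n). *)
Definition rapidly_decreasing f : Prop :=
  forall N : nat, exists C : R, forall k, cabs (f k) <= C * (1 + enorm k) ^- N.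

Definition dot k w : R := \sum_i (k ord0 i)%:~R * tnth w i.

(* e^{2 pi i t} *)
Definition cexp2pi (t : R) : R[i] := cos (2 * pi * t) +i* sin (2 * pi * t).

Definition translation m f : Zn n -> R[i] := fun k => f (k - m).

Definition modulation w f : Zn n -> R[i] := fun k => cexp2pi (dot k w) * f k.

(* The Fourier transform given by its (pointwise) series; to be used for
   absolutely summable f only. *)
Definition fourier f xi : R[i] := csum (fun k => cexp2pi (- dot k xi) * f k).

(* F represents the Fourier transform of f in l^2(Z^n), i.e. the series
   converges unconditionally to F in L^2(T^n). *)
Definition is_fourier_l2 f F : Prop :=
  in_Lp 2%:E F /\
  (fun A : {fset Zn n} =>
     normLp 2%:E (fun xi => F xi - \sum_(k <- A) cexp2pi (- dot k xi) * f k))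
    @ summability.totally --> (0%E : \bar R).

(* A representative, unique up to a null set, of the Fourier transform of f in
   l^2(Z^n). *)
Definition fourier_l2 f : torus R n -> R[i] :=
  xget (fun=> 0) [set F | is_fourier_l2 f F].

(* u = T_mu f *)
Definition is_multiplier (mu : torus R n -> R[i]) f u : Prop :=
  in_l2 u /\
  {ae haar R n, forall xi, fourier_l2 u xi = mu xi * fourier_l2 f xi}.

Definition multiplier (mu : torus R n -> R[i]) f : Zn n -> R[i] :=
  xget (fun=> 0) [set u | is_multiplier mu f u].

Definition stft g f m w : R[i] := inner f (modulation w (translation m g)).

Definition localization_form g1 g2 (s : Zn n -> torus R n -> R[i]) f h : R[i] :=
  csum (fun m => cint (fun w => s m w * stft g1 f m w * (stft g2 h m w)^*)).

(* u is the element of l^2(Z^n) defined weakly by the localization form. *)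
Definition is_localization g1 g2 (s : Zn n -> torus R n -> R[i]) f u : Prop :=
  in_l2 u /\ forall h, in_l2 h -> inner u h = localization_form g1 g2 s f h.

Definition localization g1 g2 (s : Zn n -> torus R n -> R[i]) f : Zn n -> R[i] :=
  xget (fun=> 0) [set u | is_localization g1 g2 s f u].

End Definitions.

(* Main.v *)
Require Import Defs.
From HB Require Import structures.
From mathcomp Require Import all_boot all_order all_algebra.
From mathcomp Require Import finmap.
From mathcomp Require Import all_classical all_reals all_analysis.
From mathcomp Require Import complex.
From mathcomp Require Import measurable_realfun ess_sup_inf ring lra.

Set Implicit Arguments.
Unset Strict Implicit.
Unset Printing Implicit Defensive.

Import Order.TTheory GRing.Theory Num.Theory.
Import numFieldNormedType.Exports.

Local Open Scope classical_set_scope.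
Local Open Scope ring_scope.
Local Open Scope complex_scope.

(** Both sides of the identity are convolution with one summable kernel [K] on
    the lattice. Let [B j] be the integral of [beta w * cexp2pi (dot j w)], let
    [G j] be the sum over [p] of [conj (g1 p) * g2 (p + j)], and let
    [K j = B j * G j] ([char_coef], [cross_corr], [loc_kernel]).

    Expanding the two short-time Fourier transforms and integrating over the
    torus turns the localization form into the sum over [m], [k], [l] of
    [f k * conj (h l) * conj (g1 (k - m)) * g2 (l - m) * B (l - k)]. Summing over
    [m] first produces [G (l - k)], so the form is [inner (conv K f) h]
    ([localization_form_conv]). Absolute convergence of the triple sum for
    square-summable [f] and [h] is [quadrilinear_bound]; it also gives Young's
    inequality [young], by which [conv K f] is square summable.

    The same expansion without [f] and [h] shows that the symbol [mu] is at every
    point the Fourier series of [K] ([symbol_fourier]), and the convolution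
    theorem [is_fourier_l2_conv] says that [conv K f] has the Fourier transform
    [fourier K] times that of [f]. Hence [conv K f] is the value of the Fourier
    multiplier.

    The Fourier transform on l2 is an L2 limit of trigonometric polynomials. The
    orthogonality of characters, [cint_cexp2pi], gives Parseval's identity for
    trigonometric polynomials, [sqint_trig], by which the partial sums are Cauchy
    and have a limit ([Riesz_Fischer]) that determines the sequence
    ([fourier_l2_inj]). This injectivity identifies the sequence chosen by
    [multiplier] with [conv K f].

    All interchanges of sums and integrals come down to Fubini's theorem for
    absolutely summable families, [gsum_pair], and to [cint_gsum]. *)

#[local] Existing Instance summability.totally_filter.

(** * Unconditional sums of real families *)

Notation rsum := summability.sum.

Section RealSums.
Context {R : realType}.

Definition rsummable {I : choiceType} (x : I -> R) : Prop :=
  (\esum_(i in setT) `|x i|%:E < +oo)%E.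

Section OneIndex.
Context {I : choiceType}.
Implicit Types (x y : I -> R) (A B : {fset I}).

Local Notation psum := (@summability.partial_sum _ R).
Local Notation tot := (@summability.totally I).

Lemma partial_sumE x A : psum x A = \sum_(i <- A) x i.
Proof. by rewrite /summability.partial_sum big_seq_fsetE. Qed.

(** Writes sums over different finite sets over one common superset, where they
    can be compared term by term. *)
Lemma big_fset_sub (V : nmodType) (f : I -> V) A B : (A `<=` B)%fset ->
  \sum_(i <- A) f i = \sum_(i <- B) (if i \in A then f i else 0).
Proof.
move=> AB; rewrite -(big_fset_incl _ AB); last by move=> i _ /negbTE ->.
by apply: eq_big_seq => i ->.
Qed.

Lemma ler_sum_fset_sub x A B : (A `<=` B)%fset -> (forall i, 0 <= x i) ->
  \sum_(i <- A) x i <= \sum_(i <- B) x i.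
Proof.
move=> AB x0; rewrite (big_fset_sub _ AB); apply: ler_sum => i _.
by case: ifP.
Qed.

Lemma fset_sum_le_esum x A : (forall i, 0 <= x i) ->
  ((\sum_(i <- A) x i)%:E <= \esum_(i in setT) (x i)%:E)%E.
Proof.
move=> x0; apply: esum_ge; exists [set` A]; first by split.
by rewrite fsbig_finite// set_fsetK sumEFin.
Qed.

Lemma esum_fin_num x : (forall i, 0 <= x i) ->
  (\esum_(i in setT) (x i)%:E < +oo)%E -> (\esum_(i in setT) (x i)%:E)%E \is a fin_num.
Proof.
by move=> x0 xfin; rewrite ge0_fin_numE//; apply: esum_ge0 => i _; rewrite lee_fin.
Qed.

Lemma esum_le_bound x (C : R) : (forall i, 0 <= x i) ->
  (forall A, \sum_(i <- A) x i <= C) -> (\esum_(i in setT) (x i)%:E <= C%:E)%E.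
Proof.
move=> x0 xC; apply: ge_ereal_sup => _ [X [finX _] <-].
by rewrite fsbig_finite// sumEFin lee_fin.
Qed.

Lemma cvg_partial_sum_ge0 x : (forall i, 0 <= x i) ->
  (\esum_(i in setT) (x i)%:E < +oo)%E ->
  psum x @ tot --> fine (\esum_(i in setT) (x i)%:E)%E.
Proof.
move=> x0 xfin.
have sf := esum_fin_num x0 xfin.
apply/cvgrPdist_le => e e0.
have [A Ae] : exists A, fine (\esum_(i in setT) (x i)%:E)%E - e < \sum_(i <- A) x i.
  have [_ [X [finX _] <-]] := ub_ereal_sup_adherent e0 sf.
  rewrite fsbig_finite// sumEFin => h; exists (fset_set X).
  by rewrite -lte_fin EFinB fineK.
exists A => // B /= AB; rewrite partial_sumE.
have BS := fset_sum_le_esum B x0.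
have ABl := ler_sum_fset_sub AB x0.
rewrite ger0_norm ?subr_ge0 -?lee_fin ?fineK//.
by rewrite lee_fin lerBlDr -lerBlDl (le_trans (ltW Ae)).
Qed.

Lemma rsummable_le x y : (forall i, `|x i| <= y i) -> rsummable y -> rsummable x.
Proof.
move=> xy; apply: le_lt_trans; apply: le_esum => i _.
by rewrite lee_fin (le_trans (xy i))// ler_norm.
Qed.

Lemma rsummableZ c x : rsummable x -> rsummable (fun i => c * x i).
Proof.
move=> xfin.
have sf : (\esum_(i in setT) `|x i|%:E)%E \is a fin_num by exact: esum_fin_num.
apply: (@le_lt_trans _ _ (`|c| * fine (\esum_(i in setT) `|x i|%:E)%E)%:E); last first.
  exact: ltry.
apply: esum_le_bound => // A; under eq_bigr do rewrite normrM.
rewrite -mulr_sumr ler_wpM2l// -lee_fin fineK//.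
exact: (fset_sum_le_esum A (fun i => normr_ge0 (x i))).
Qed.

Lemma rsummableD x y : rsummable x -> rsummable y -> rsummable (fun i => x i + y i).
Proof.
move=> xfin yfin; apply: le_lt_trans (lte_add_pinfty xfin yfin).
rewrite -esumD//; apply: le_esum => i _; rewrite -EFinD lee_fin; exact: ler_normD.
Qed.

Lemma rsummable_norm x : rsummable x -> rsummable (fun i => `|x i|).
Proof.
by apply: le_lt_trans; apply: le_esum => i _; rewrite normr_id.
Qed.

Lemma rsummableB x y : rsummable x -> rsummable y -> rsummable (fun i => x i - y i).
Proof.
move=> sx sy; apply: rsummableD => //.
by apply: rsummable_le (rsummable_norm sy) => i; rewrite normrN.
Qed.

Lemma cvg_is_rsum x (l : R) : psum x @ tot --> l -> rsum x = l.
Proof. exact: cvg_lim. Qed.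

Lemma ge0_rsumE x : (forall i, 0 <= x i) -> rsummable x ->
  rsum x = fine (\esum_(i in setT) (x i)%:E)%E.
Proof.
move=> x0 sx; apply: cvg_is_rsum; apply: cvg_partial_sum_ge0 => //.
by apply: le_lt_trans sx; apply: le_esum => i _; rewrite lee_fin ler_norm.
Qed.

Lemma EFin_rsum x : (forall i, 0 <= x i) -> rsummable x ->
  (rsum x)%:E = (\esum_(i in setT) (x i)%:E)%E.
Proof.
move=> x0 sx; rewrite ge0_rsumE// fineK// esum_fin_num//.
by apply: le_lt_trans sx; apply: le_esum => i _; rewrite lee_fin ler_norm.
Qed.

(** The decomposition [x = (|x| + x) - |x|] reduces summable families to
    nonnegative ones, whose sum is a supremum of finite sums. *)
Lemma cvg_rsum x : rsummable x -> psum x @ tot --> rsum x.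
Proof.
move=> sx.
have cvg0 y : (forall i, 0 <= y i) -> rsummable y -> psum y @ tot --> rsum y.
  move=> y0 sy; rewrite ge0_rsumE//; apply: cvg_partial_sum_ge0 => //.
  by apply: le_lt_trans sy; apply: le_esum => i _; rewrite lee_fin ler_norm.
have c : psum x @ tot --> rsum (fun i => `|x i| + x i) - rsum (fun i => `|x i|).
  rewrite (_ : psum x = psum (fun i => `|x i| + x i) \- psum (fun i => `|x i|)).
    apply: cvgB; apply: cvg0 => //.
    - by move=> i; rewrite -lerBlDl sub0r lerNl ler_normlW// normrN.
    - by apply: rsummableD => //; exact: rsummable_norm.
    - exact: rsummable_norm.
  apply/funext => A /=; rewrite !partial_sumE -sumrB.
  by apply: eq_bigr => i _; rewrite addrC addKr.
by rewrite (cvg_is_rsum c).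
Qed.

Lemma rsumD x y : rsummable x -> rsummable y ->
  rsum (fun i => x i + y i) = rsum x + rsum y.
Proof.
move=> sx sy; apply: cvg_is_rsum.
rewrite (_ : psum _ = psum x \+ psum y); first by apply: cvgD; exact: cvg_rsum.
by apply/funext => A /=; rewrite !partial_sumE big_split.
Qed.

Lemma rsumZ c x : rsummable x -> rsum (fun i => c * x i) = c * rsum x.
Proof.
move=> sx; apply: cvg_is_rsum.
rewrite (_ : psum _ = (fun A => c * psum x A)); first by apply: cvgMr; exact: cvg_rsum.
by apply/funext => A /=; rewrite !partial_sumE mulr_sumr.
Qed.

Lemma rsumB x y : rsummable x -> rsummable y ->
  rsum (fun i => x i - y i) = rsum x - rsum y.
Proof.
move=> sx sy; apply: cvg_is_rsum.
rewrite (_ : psum _ = psum x \- psum y); first by apply: cvgB; exact: cvg_rsum.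
by apply/funext => A /=; rewrite !partial_sumE sumrB.
Qed.

Lemma eq_rsum x y : x =1 y -> rsum x = rsum y.
Proof. by move=> /funext ->. Qed.

Lemma sum_fset_le_rsum x A : (forall i, 0 <= x i) -> rsummable x ->
  \sum_(i <- A) x i <= rsum x.
Proof. by move=> x0 sx; rewrite -lee_fin EFin_rsum// fset_sum_le_esum. Qed.

Lemma rsum_ge0 x : (forall i, 0 <= x i) -> rsummable x -> 0 <= rsum x.
Proof. by move=> x0 sx; have := sum_fset_le_rsum fset0 x0 sx; rewrite big_seq_fset0. Qed.

(** The error made by cutting off an unconditional sum at a finite set is
    at most the corresponding error for a dominating family. *)
Lemma rsum_tail x y A : (forall i, `|x i| <= y i) -> rsummable y ->
  `|rsum x - \sum_(i <- A) x i| <= rsum y - \sum_(i <- A) y i.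
Proof.
move=> xy sy; have sx := rsummable_le xy sy.
have y0 i : 0 <= y i by exact: le_trans (xy i).
have c : `|psum x B - \sum_(i <- A) x i| @[B --> tot] -->
    `|rsum x - \sum_(i <- A) x i|.
  by apply: cvg_norm; apply: cvgB; [exact: cvg_rsum|exact: cvg_cst].
apply: (cvgr_to_le c).
exists A => // B /= AB; rewrite partial_sumE.
rewrite (big_fset_sub _ AB) -sumrB (le_trans (ler_norm_sum _ _ _))//.
apply: (@le_trans _ _ (\sum_(i <- B) y i - \sum_(i <- A) y i)).
  rewrite (big_fset_sub _ AB) -sumrB; apply: ler_sum => i _.
  by case: ifP => _; rewrite ?subrr ?normr0 ?subr0.
by rewrite lerB// sum_fset_le_rsum.
Qed.

Lemma ler_norm_rsum x y : (forall i, `|x i| <= y i) -> rsummable y ->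
  `|rsum x| <= rsum y.
Proof. by move=> xy sy; have := rsum_tail fset0 xy sy; rewrite !big_seq_fset0 !subr0. Qed.

Lemma rsum_fset_support x A : (forall i, i \notin A -> x i = 0) ->
  rsum x = \sum_(i <- A) x i.
Proof.
move=> xA; apply: cvg_is_rsum; apply: cvg_near_cst; exists A => // B /= AB.
by rewrite partial_sumE; apply/esym/big_fset_incl => // i _ /xA.
Qed.

End OneIndex.

Lemma rsummable_comp (I J : choiceType) (e : I -> J) (e' : J -> I) (x : J -> R) :
  cancel e e' -> cancel e' e -> rsummable x -> rsummable (x \o e).
Proof.
move=> ee' e'e; rewrite /rsummable (reindex_esum setT setT e)//.
split=> //; first by move=> i j _ _; exact: (can_inj ee').
by move=> j _; exists (e' j).
Qed.

(** The decomposition [x = (|x| + x) - |x|] transfers the reindexing of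
    nonnegative sums. *)
Lemma reindex_rsum (I J : choiceType) (e : I -> J) (e' : J -> I) (x : J -> R) :
  cancel e e' -> cancel e' e -> rsummable x -> rsum x = rsum (x \o e).
Proof.
move=> ee' e'e sx.
have bij : set_bij setT setT e.
  split=> //; first by move=> i j _ _; exact: (can_inj ee').
  by move=> j _; exists (e' j).
have sx' := rsummable_norm sx.
have x'0 i : 0 <= `|x i| + x i by rewrite -lerBlDl sub0r lerNl ler_normlW// normrN.
have sx'' := rsummableD sx' sx.
have re (y : J -> R) : (forall j, 0 <= y j) -> rsummable y -> rsum y = rsum (y \o e).
  move=> y0 sy; rewrite !ge0_rsumE// ?(reindex_esum setT setT e)//.
    by move=> i; exact: y0.
  exact: rsummable_comp ee' e'e sy.
transitivity (rsum (fun i => `|x i| + x i) - rsum (fun i => `|x i|)).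
  by rewrite -rsumB//; apply: eq_rsum => j; rewrite addrC addKr.
rewrite (re _ x'0)// (re (fun i => `|x i|))// -rsumB; last 2 first.
- exact: rsummable_comp ee' e'e sx''.
- exact: rsummable_comp ee' e'e sx'.
by apply: eq_rsum => j /=; rewrite addrC addKr.
Qed.

Lemma pair_esum (I J : choiceType) (x : I * J -> \bar R) : (forall p, 0 <= x p)%E ->
  (\esum_(p in setT) x p = \esum_(i in setT) \esum_(j in setT) x (i, j))%E.
Proof.
move=> x0; rewrite esum_esum//.
rewrite (_ : [set: I] `*`` (fun=> [set: J]) = setT); last by apply/seteqP; split.
by apply: eq_esum => -[].
Qed.

Lemma rsummable_section (I J : choiceType) (x : I * J -> R) i :
  rsummable x -> rsummable (fun j => x (i, j)).
Proof.
rewrite /rsummable pair_esum//; apply: le_lt_trans.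
rewrite -[leLHS](@esum_set1 _ _ i (fun i => \esum_(j in setT) `|x (i, j)|%:E))%E//; last first.
  by apply: esum_ge0 => j _; rewrite lee_fin.
rewrite esum_mkcond; apply: le_esum => k _; case: ifP => // _.
by apply: esum_ge0 => j _; rewrite lee_fin.
Qed.

Lemma rsummable_rsum (I J : choiceType) (x : I * J -> R) :
  rsummable x -> rsummable (fun i => rsum (fun j => x (i, j))).
Proof.
move=> sx; have := sx; rewrite {1}/rsummable pair_esum//; apply: le_lt_trans.
apply: le_esum => i _.
have s := rsummable_section i sx.
rewrite -EFin_rsum//; last exact: rsummable_norm.
rewrite lee_fin ler_norm_rsum//; exact: rsummable_norm.
Qed.

(** Fubini's theorem for absolutely summable families, from its version for
    nonnegative families through [x = (|x| + x) - |x|]. *)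
Lemma rsum_pair (I J : choiceType) (x : I * J -> R) : rsummable x ->
  rsum x = rsum (fun i => rsum (fun j => x (i, j))).
Proof.
move=> sx.
have sx' := rsummable_norm sx.
have x'0 i : 0 <= `|x i| + x i by rewrite -lerBlDl sub0r lerNl ler_normlW// normrN.
have sx'' := rsummableD sx' sx.
have re (y : I * J -> R) : (forall p, 0 <= y p) -> rsummable y ->
    rsum y = rsum (fun i => rsum (fun j => y (i, j))).
  move=> y0 sy; rewrite !ge0_rsumE//.
  - rewrite pair_esum//; congr fine; apply: eq_esum => i _.
    by rewrite EFin_rsum//; exact: rsummable_section.
  - by move=> i; apply: rsum_ge0 => //; exact: rsummable_section.
  - exact: rsummable_rsum.
transitivity (rsum (fun i => `|x i| + x i) - rsum (fun i => `|x i|)).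
  by rewrite -rsumB//; apply: eq_rsum => j; rewrite addrC addKr.
rewrite (re _ x'0)// (re (fun i => `|x i|))// -rsumB; last 2 first.
- exact: rsummable_rsum sx''.
- exact: rsummable_rsum sx'.
apply: eq_rsum => i; rewrite -rsumB; last 2 first.
- exact: rsummable_section sx''.
- exact: rsummable_section sx'.
by apply: eq_rsum => j /=; rewrite addrC addKr.
Qed.

End RealSums.

Section MoreRealSums.
Context {R : realType}.

(** Tonelli's criterion. *)
Lemma rsummable_pair (I J : choiceType) (x : I * J -> R) :
  (forall i, rsummable (fun j => x (i, j))) ->
  rsummable (fun i => rsum (fun j => `|x (i, j)|)) -> rsummable x.
Proof.
move=> sj; rewrite /rsummable pair_esum//; apply: le_lt_trans; apply: le_esum => i _.
rewrite -EFin_rsum//; last exact: rsummable_norm.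
by rewrite lee_fin ler_norm.
Qed.

Lemma rsummableM (I J : choiceType) (x : I -> R) (y : J -> R) :
  rsummable x -> rsummable y -> rsummable (fun p : I * J => x p.1 * y p.2).
Proof.
move=> sx sy; apply: rsummable_pair => [i|]; first exact: (rsummableZ (x i) sy).
apply: (@rsummable_le _ _ _ (fun i => rsum (fun j => `|y j|) * `|x i|)).
  move=> i /=; rewrite (@eq_rsum _ _ _ (fun j => `|x i| * `|y j|)); last first.
    by move=> j; rewrite normrM.
  have sy' := rsummable_norm sy.
  have ge0 := rsum_ge0 (fun j => normr_ge0 (y j)) sy'.
  by rewrite rsumZ// ger0_norm ?mulr_ge0// mulrC.
exact/rsummableZ/rsummable_norm.
Qed.
Lemma rsumM (I J : choiceType) (x : I -> R) (y : J -> R) :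
  rsummable x -> rsummable y ->
  rsum (fun p : I * J => x p.1 * y p.2) = rsum x * rsum y.
Proof.
move=> sx sy; rewrite rsum_pair; last exact: rsummableM.
rewrite mulrC -rsumZ//; apply: eq_rsum => i /=.
by rewrite rsumZ// mulrC.
Qed.

Lemma rsummable_fset_support (I : choiceType) (x : I -> R) (A : {fset I}) :
  (forall i, i \notin A -> x i = 0) -> rsummable x.
Proof.
move=> xA; apply: (@le_lt_trans _ _ (\sum_(i <- A) `|x i|)%:E); last exact: ltry.
apply: esum_le_bound => // B.
rewrite (big_fset_sub _ (fsubsetUl B A)) (big_fset_sub _ (fsubsetUr B A)).
apply: ler_sum => i _; case: ifP => _; case: (boolP (i \in A)) => // /xA ->.
by rewrite normr0.
Qed.

End MoreRealSums.

(** * Complex modulus and unconditional sums of complex families *)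

Section ComplexModulus.
Context {R : realType}.
(* In [ring_scope], [z^*] would be the conjugation of the closed field structure
   of [R[i]]; [num_conjE] below passes from it to [conjc]. *)
Local Notation "z ^*" := (conjc z) : ring_scope.
Implicit Types z : R[i].

Lemma cabs_sqr z : cabs z ^+ 2 = complex.Re z ^+ 2 + complex.Im z ^+ 2.
Proof. by case: z => a b /=; rewrite sqr_sqrtr// addr_ge0 ?sqr_ge0. Qed.

Lemma cabs_ge0 z : 0 <= cabs z.
Proof. by case: z => a b; exact: sqrtr_ge0. Qed.

Lemma ler_cabsD z1 z2 : cabs (z1 + z2) <= cabs z1 + cabs z2.
Proof. exact: (@le_normcD R z1 z2). Qed.

Lemma cabsN z : cabs (- z) = cabs z.
Proof. exact: (@normcN R z). Qed.

Lemma cabsJ z : cabs z^* = cabs z.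
Proof. by case: z => a b /=; rewrite sqrrN. Qed.

Lemma cabsM z1 z2 : cabs (z1 * z2) = cabs z1 * cabs z2.
Proof. exact: ComplexField.Normc.normcM. Qed.

Lemma ler_Re_cabs z : `|complex.Re z| <= cabs z.
Proof.
rewrite -(@ler_pXn2r _ 2)// ?nnegrE ?cabs_ge0// cabs_sqr real_normK ?num_real//.
by rewrite lerDl sqr_ge0.
Qed.

Lemma ler_Im_cabs z : `|complex.Im z| <= cabs z.
Proof.
rewrite -(@ler_pXn2r _ 2)// ?nnegrE ?cabs_ge0// cabs_sqr real_normK ?num_real//.
by rewrite lerDr sqr_ge0.
Qed.

Lemma ReD z1 z2 : complex.Re (z1 + z2) = complex.Re z1 + complex.Re z2.
Proof. by case: z1 z2 => [? ?] [? ?]. Qed.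

Lemma ImD z1 z2 : complex.Im (z1 + z2) = complex.Im z1 + complex.Im z2.
Proof. by case: z1 z2 => [? ?] [? ?]. Qed.

Lemma ReN z : complex.Re (- z) = - complex.Re z.
Proof. by case: z. Qed.

Lemma ImN z : complex.Im (- z) = - complex.Im z.
Proof. by case: z. Qed.

Lemma ReM z1 z2 : complex.Re (z1 * z2) =
  complex.Re z1 * complex.Re z2 - complex.Im z1 * complex.Im z2.
Proof. by case: z1 z2 => [? ?] [? ?]. Qed.

Lemma ImM z1 z2 : complex.Im (z1 * z2) =
  complex.Re z1 * complex.Im z2 + complex.Im z1 * complex.Re z2.
Proof. by case: z1 z2 => [? ?] [? ?]. Qed.

Lemma ReJ z : complex.Re z^* = complex.Re z.
Proof. by case: z. Qed.

Lemma ImJ z : complex.Im z^* = - complex.Im z.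
Proof. by case: z. Qed.

Lemma Re_sum (I : Type) (r : seq I) (a : I -> R[i]) :
  complex.Re (\sum_(i <- r) a i) = \sum_(i <- r) complex.Re (a i).
Proof. by apply: (big_morph (@complex.Re R)) => //; exact: ReD. Qed.

Lemma Im_sum (I : Type) (r : seq I) (a : I -> R[i]) :
  complex.Im (\sum_(i <- r) a i) = \sum_(i <- r) complex.Im (a i).
Proof. by apply: (big_morph (@complex.Im R)) => //; exact: ImD. Qed.

Lemma complex_ext z1 z2 : complex.Re z1 = complex.Re z2 ->
  complex.Im z1 = complex.Im z2 -> z1 = z2.
Proof. by case: z1 z2 => [? ?] [? ?] /= -> ->. Qed.

(** The modulus is the largest real part among the rotations of [z]. *)
Lemma cabs_le_rotation z (C : R) :
  (forall c : R[i], cabs c = 1 -> complex.Re (c * z) <= C) -> cabs z <= C.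
Proof.
move=> h; have [z0|z0] := eqVneq (cabs z) 0.
  have := h 1; rewrite ComplexField.Normc.normc1 mul1r => /(_ erefl).
  by rewrite (ComplexField.Normc.eq0_normc z0) ComplexField.Normc.normc0.
have k : cabs ((cabs z)^-1 +i* 0) = (cabs z)^-1.
  by rewrite /= expr0n/= addr0 sqrtr_sqr ger0_norm// invr_ge0 cabs_ge0.
have := h (((cabs z)^-1 +i* 0) * z^*); rewrite cabsM cabsJ k mulVf// => /(_ erefl).
apply: le_trans; rewrite -mulrA ReM/= mul0r subr0 ReM ReJ ImJ mulNr opprK.
by rewrite -!expr2 -cabs_sqr expr2 mulrA mulVf// mul1r.
Qed.

Lemma ler_cabs_sum (I : Type) (s : seq I) (a : I -> R[i]) :
  cabs (\sum_(i <- s) a i) <= \sum_(i <- s) cabs (a i).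
Proof.
elim: s => [|i s IH]; first by rewrite !big_nil ComplexField.Normc.normc0.
by rewrite !big_cons (le_trans (ler_cabsD _ _))// lerD2l.
Qed.

Lemma conjM (z1 z2 : R[i]) : (z1 * z2)^* = z1^* * z2^*.
Proof. exact: (rmorphM (@conjc R)). Qed.

Lemma mulCJ (z : R[i]) : z * z^* = (cabs z ^+ 2) +i* 0.
Proof.
apply: complex_ext; rewrite ?ReM ?ImM ReJ ImJ /=.
  by rewrite cabs_sqr mulrN opprK !expr2.
by rewrite mulrN mulrC addNr.
Qed.

Lemma cabs_sqrB (z t : R[i]) : cabs (z - t) ^+ 2 =
  (complex.Re z - complex.Re t) ^+ 2 + (complex.Im z - complex.Im t) ^+ 2.
Proof. by rewrite cabs_sqr ReD ReN ImD ImN. Qed.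

End ComplexModulus.

Section ComplexSums.
Context {R : realType}.
Local Notation "z ^*" := (conjc z) : ring_scope.

(** The sum [csum] over an arbitrary index type; sums over pairs and triples of
    lattice points are needed as well. *)
Definition gsum {I : choiceType} (a : I -> R[i]) : R[i] :=
  rsum (fun i => complex.Re (a i)) +i* rsum (fun i => complex.Im (a i)).

Definition csummable {I : choiceType} (a : I -> R[i]) : Prop :=
  rsummable (fun i => cabs (a i)).

Section OneIndex.
Context {I : choiceType}.
Implicit Types (a b : I -> R[i]) (y : I -> R) (A : {fset I}).

Lemma csummable_Re a : csummable a -> rsummable (fun i => complex.Re (a i)).
Proof. by apply: rsummable_le => i; exact: ler_Re_cabs. Qed.

Lemma csummable_Im a : csummable a -> rsummable (fun i => complex.Im (a i)).
Proof. by apply: rsummable_le => i; exact: ler_Im_cabs. Qed.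

Lemma csummable_le a y : (forall i, cabs (a i) <= y i) -> rsummable y -> csummable a.
Proof. by move=> ay; apply: rsummable_le => i; rewrite ger0_norm ?cabs_ge0. Qed.

Lemma csummableN a : csummable a -> csummable (fun i => - a i).
Proof. by apply: csummable_le => i; rewrite cabsN. Qed.

Lemma csummableJ a : csummable a -> csummable (fun i => (a i)^*).
Proof. by apply: csummable_le => i; rewrite cabsJ. Qed.

Lemma eq_gsum a b : a =1 b -> gsum a = gsum b.
Proof. by move=> /funext ->. Qed.

Lemma gsumD a b : csummable a -> csummable b ->
  gsum (fun i => a i + b i) = gsum a + gsum b.
Proof.
move=> sa sb; apply: complex_ext => /=.
- rewrite -rsumD; [|exact: csummable_Re..].
  by apply: eq_rsum => i; rewrite ReD.
- rewrite -rsumD; [|exact: csummable_Im..].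
  by apply: eq_rsum => i; rewrite ImD.
Qed.

Lemma gsumZ c a : csummable a -> gsum (fun i => c * a i) = c * gsum a.
Proof.
move=> sa; have sR := csummable_Re sa; have sI := csummable_Im sa.
apply: complex_ext; rewrite ?ReM ?ImM /= -2?rsumZ//.
- rewrite -rsumB; [|exact: (rsummableZ _ sR)|exact: (rsummableZ _ sI)].
  by apply: eq_rsum => i; rewrite ReM.
- rewrite -rsumD; [|exact: (rsummableZ _ sI)|exact: (rsummableZ _ sR)].
  by apply: eq_rsum => i; rewrite ImM.
Qed.

Lemma gsumZr c a : csummable a -> gsum (fun i => a i * c) = gsum a * c.
Proof.
by move=> sa; rewrite mulrC -gsumZ//; apply: eq_gsum => i; rewrite mulrC.
Qed.

Lemma gsumB a b : csummable a -> csummable b ->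
  gsum (fun i => a i - b i) = gsum a - gsum b.
Proof.
move=> sa sb; rewrite gsumD//; last exact: csummableN.
congr (_ + _); rewrite -mulN1r -gsumZ//.
by apply: eq_gsum => i; rewrite mulN1r.
Qed.

Lemma gsumJ a : csummable a -> gsum (fun i => (a i)^*) = (gsum a)^*.
Proof.
move=> sa; apply: complex_ext; rewrite ?ReJ ?ImJ /=.
  by apply: eq_rsum => i; rewrite ReJ.
rewrite -mulN1r -rsumZ; last exact: csummable_Im.
by apply: eq_rsum => i; rewrite ImJ mulN1r.
Qed.

(** Rotating the error so that its modulus becomes its real part reduces the
    bound to [rsum_tail]. *)
Lemma gsum_tail a y A : (forall i, cabs (a i) <= y i) -> rsummable y ->
  cabs (gsum a - \sum_(i <- A) a i) <= rsum y - \sum_(i <- A) y i.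
Proof.
move=> ay sy; have sa := csummable_le ay sy.
apply: cabs_le_rotation => c c1.
rewrite mulrBr -gsumZ// mulr_sumr ReD ReN Re_sum /=.
apply: le_trans (ler_norm _) _; apply: rsum_tail => // i.
by rewrite (le_trans (ler_Re_cabs _))// cabsM c1 mul1r.
Qed.

Lemma ler_cabs_gsum a y : (forall i, cabs (a i) <= y i) -> rsummable y ->
  cabs (gsum a) <= rsum y.
Proof. by move=> ay sy; have := gsum_tail fset0 ay sy; rewrite !big_seq_fset0 !subr0. Qed.

Lemma gsum_fset_support a A : (forall i, i \notin A -> a i = 0) ->
  gsum a = \sum_(i <- A) a i.
Proof.
move=> aA; apply: complex_ext; rewrite ?Re_sum ?Im_sum /=.
  by apply: rsum_fset_support => i /aA ->.
by apply: rsum_fset_support => i /aA ->.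
Qed.

End OneIndex.

Lemma csummable_comp (I J : choiceType) (e : I -> J) (e' : J -> I) (a : J -> R[i]) :
  cancel e e' -> cancel e' e -> csummable a -> csummable (a \o e).
Proof. exact: rsummable_comp. Qed.

Lemma reindex_gsum (I J : choiceType) (e : I -> J) (e' : J -> I) (a : J -> R[i]) :
  cancel e e' -> cancel e' e -> csummable a -> gsum a = gsum (a \o e).
Proof.
move=> ee' e'e sa; apply: complex_ext => /=.
- by rewrite (reindex_rsum ee' e'e)//; exact: csummable_Re.
- by rewrite (reindex_rsum ee' e'e)//; exact: csummable_Im.
Qed.

Lemma csummable_section (I J : choiceType) (a : I * J -> R[i]) i :
  csummable a -> csummable (fun j => a (i, j)).
Proof. exact: rsummable_section. Qed.

Lemma gsum_pair (I J : choiceType) (a : I * J -> R[i]) : csummable a ->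
  gsum a = gsum (fun i => gsum (fun j => a (i, j))).
Proof.
move=> sa; apply: complex_ext => /=.
- by rewrite rsum_pair//; exact: csummable_Re.
- by rewrite rsum_pair//; exact: csummable_Im.
Qed.

Lemma csummable_gsum (I J : choiceType) (a : I * J -> R[i]) : csummable a ->
  csummable (fun i => gsum (fun j => a (i, j))).
Proof.
move=> sa; apply: csummable_le (rsummable_rsum sa) => i.
by apply: ler_cabs_gsum => //; exact: csummable_section.
Qed.

Lemma csummable_swap (I J : choiceType) (a : I * J -> R[i]) : csummable a ->
  csummable (fun p : J * I => a (p.2, p.1)).
Proof.
move=> sa.
have c (I1 I2 : Type) : cancel (fun p : I1 * I2 => (p.2, p.1)) (fun p => (p.2, p.1)).
  by case.
rewrite (_ : (fun p : J * I => a (p.2, p.1)) = a \o (fun p : J * I => (p.2, p.1)))//.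
exact: (csummable_comp (c J I) (c I J) sa).
Qed.

Lemma gsum_pair_swap (I J : choiceType) (a : I * J -> R[i]) : csummable a ->
  gsum a = gsum (fun j => gsum (fun i => a (i, j))).
Proof.
move=> sa.
have c (I1 I2 : Type) : cancel (fun p : I1 * I2 => (p.2, p.1)) (fun p => (p.2, p.1)).
  by case.
rewrite (reindex_gsum (c J I) (c I J))//.
by rewrite gsum_pair//; exact: csummable_swap.
Qed.

Lemma csummableM (I J : choiceType) (a : I -> R[i]) (b : J -> R[i]) :
  csummable a -> csummable b -> csummable (fun p : I * J => a p.1 * b p.2).
Proof.
by move=> sa sb; apply: csummable_le (rsummableM sa sb) => i; rewrite cabsM.
Qed.

Lemma gsumM (I J : choiceType) (a : I -> R[i]) (b : J -> R[i]) :
  csummable a -> csummable b ->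
  gsum a * gsum b = gsum (fun p : I * J => a p.1 * b p.2).
Proof.
move=> sa sb; rewrite gsum_pair /=; last exact: csummableM.
by rewrite -gsumZr//; apply: eq_gsum => i; rewrite gsumZ.
Qed.

End ComplexSums.

Section Characters.
Context {R : realType}.
Local Notation "z ^*" := (conjc z) : ring_scope.
Implicit Types s t : R.

Lemma cexp2pi0 : cexp2pi (0 : R) = 1.
Proof. by rewrite /cexp2pi mulr0 cos0 sin0. Qed.

Lemma cexp2piD s t : cexp2pi (s + t) = cexp2pi s * cexp2pi t.
Proof.
rewrite /cexp2pi mulrDr cosD sinD; apply: complex_ext; first by rewrite ReM.
by rewrite ImM/= addrC.
Qed.

Lemma cexp2piJ t : (cexp2pi t)^* = cexp2pi (- t).
Proof. by rewrite /cexp2pi mulrN cosN sinN. Qed.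

Lemma cabs_cexp2pi t : cabs (cexp2pi t) = 1.
Proof. by rewrite /cexp2pi /= cos2Dsin2 sqrtr1. Qed.

Context {n : nat}.
Implicit Types (k l : Zn n) (w : torus R n).

Lemma dotD k l w : dot (k + l) w = dot k w + dot l w.
Proof.
by rewrite /dot -big_split; apply: eq_bigr => i _; rewrite mxE intrD mulrDl.
Qed.

Lemma dotN k w : dot (- k) w = - dot k w.
Proof.
by rewrite /dot -sumrN; apply: eq_bigr => i _; rewrite mxE intrN mulNr.
Qed.

Lemma dotB k l w : dot (k - l) w = dot k w - dot l w.
Proof. by rewrite dotD dotN. Qed.

Lemma dot0 w : dot 0 w = 0.
Proof. by rewrite /dot big1// => i _; rewrite mxE mul0r. Qed.

Lemma csumE (a : Zn n -> R[i]) : csum a = gsum a.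
Proof. by []. Qed.

End Characters.

(** * Summability of rapidly decreasing functions *)

Section Decay.
Context {R : realType}.

Lemma rsummable_nat (x : nat -> R) (C : R) : (forall i, 0 <= x i) ->
  (forall N, \sum_(0 <= i < N) x i <= C) -> rsummable x.
Proof.
move=> x0 xC; rewrite /rsummable -nneseries_esumT//.
apply: (@le_lt_trans _ _ C%:E); last exact: ltry.
apply: lime_le; first by apply: is_cvg_nneseries.
apply: nearW => N; rewrite sumEFin lee_fin; apply: le_trans (xC N).
by apply: ler_sum => i _; rewrite ger0_norm.
Qed.

Lemma rsummable_nat_inv_sqr : rsummable (fun m : nat => (1 + m%:R ^+ 2)^-1 : R).
Proof.
have pos m : 0 < 1 + m%:R ^+ 2 :> R by rewrite ltr_pwDl// sqr_ge0.
apply: (@rsummable_nat _ 4) => [m|N]; first by rewrite invr_ge0 ltW.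
(* Telescoping: each term is at most 4 / (N + 1) - 4 / (N + 2). *)
apply: (@le_trans _ _ (4 - 4 / N.+1%:R)); last by rewrite gerBl.
elim: N => [|N IH]; first by rewrite big_geq// divr1 subrr.
rewrite big_nat_recr//= -lerBrDr (le_trans IH)// -subr_ge0.
have N0 : 0 <= N%:R :> R by [].
have N1 : 1 + N%:R != 0 :> R by rewrite gt_eqF// !ltr_pwDl// ?addr_ge0.
have N2 : 1 + (1 + N%:R) != 0 :> R by rewrite gt_eqF// !ltr_pwDl// ?addr_ge0.
have N3 : 1 + N%:R ^+ 2 != 0 :> R by rewrite gt_eqF.
rewrite (_ : _ - _ = (3 * N%:R ^+ 2 - 3 * N%:R + 2) /
  ((1 + N%:R) * (1 + (1 + N%:R)) * (1 + N%:R ^+ 2))).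
  apply: divr_ge0; last by rewrite !mulr_ge0 ?(ltW (pos N)) ?addr_ge0.
  rewrite (_ : _ + 2 = 3 * (N%:R - 2^-1) ^+ 2 + 5 / 4); last by field.
  by apply: addr_ge0; [apply: mulr_ge0 => //; exact: sqr_ge0|apply: divr_ge0].
rewrite -(nat1r N.+1) -(nat1r N); field.
by rewrite N1 N2 N3.
Qed.

Lemma rsummable_int_inv_sqr : rsummable (fun j : int => (1 + j%:~R ^+ 2)^-1 : R).
Proof.
pose x (p : bool * nat) : R :=
  (1 + (if p.1 then p.2%:R else p.2.+1%:R) ^+ 2)^-1.
have sx : rsummable x.
  have s1 : rsummable (fun b : bool => 1 : R).
    apply: (@rsummable_fset_support _ _ _ [fset true; false]%fset).
    by case; rewrite !inE.
  apply: rsummable_le (rsummableM s1 rsummable_nat_inv_sqr) => -[b m] /=.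
  have p (t : R) : 0 < 1 + t ^+ 2 by rewrite ltr_pwDl// sqr_ge0.
  rewrite mul1r ger0_norm ?invr_ge0 ?(ltW (p _))// /x/=.
  rewrite lef_pV2 ?posrE ?p// lerD2l ler_pXn2r ?nnegrE//; last by case: b.
  by case: b; rewrite ?lexx// ler_nat.
pose e (j : int) := match j with Posz m => (true, m) | Negz m => (false, m) end.
pose e' (p : bool * nat) := if p.1 then Posz p.2 else Negz p.2.
have ee' : cancel e e' by case.
have e'e : cancel e' e by case=> -[].
rewrite (_ : (fun j => _) = x \o e); first exact: rsummable_comp ee' e'e sx.
by apply/funext => -[m|m]; rewrite /x/= ?NegzE ?mulrNz ?sqrrN.
Qed.

(** Splitting off one coordinate at a time turns the sum into a product of
    one-dimensional sums. *)
Lemma rsummable_prod (c : int -> R) n : rsummable c ->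
  rsummable (fun k : Zn n => \prod_i c (k ord0 i)).
Proof.
move=> sc; elim: n => [|n IH].
  apply: (@rsummable_fset_support _ _ _ [fset 0]%fset) => k.
  by rewrite inE (thinmx0 k) eqxx.
pose e (k : Zn n.+1) : int * Zn n := (k ord0 ord0, \row_j k ord0 (lift ord0 j)).
pose e' (p : int * Zn n) : Zn n.+1 :=
  \row_i (if unlift ord0 i is Some j then p.2 ord0 j else p.1).
have ee' : cancel e e'.
  move=> k; apply/rowP => i; rewrite mxE /e /=.
  by case: unliftP => [j ->|->]; rewrite ?mxE.
have e'e : cancel e' e.
  case=> j k; rewrite /e /e' /= mxE unlift_none /=; congr pair.
  by apply/rowP => i; rewrite !mxE liftK.
have := rsummable_comp ee' e'e (rsummableM sc IH).
congr rsummable; apply/funext => k /=; rewrite big_ord_recl; congr (_ * _).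
by apply: eq_bigr => i _; rewrite mxE.
Qed.

(** Decay of order [2 * n] suffices, since each factor [1 + k_i ^+ 2] is at most
    [(1 + enorm k) ^+ 2]. *)
Lemma rapidly_decreasing_summable n (g : Zn n -> R[i]) :
  rapidly_decreasing g -> csummable g.
Proof.
move=> /(_ (2 * n)%N) [C gC].
apply: (@csummable_le _ _ _
  (fun k : Zn n => `|C| * \prod_i (1 + (k ord0 i)%:~R ^+ 2)^-1)) => [k|]; last first.
  exact: (rsummableZ `|C| (rsummable_prod n rsummable_int_inv_sqr)).
apply: le_trans (gC k) _.
have e0 : 0 <= enorm k :> R by exact: sqrtr_ge0.
have p0 : 0 < 1 + enorm k :> R by rewrite ltr_pwDl.
rewrite (@le_trans _ _ (`|C| * (1 + enorm k) ^- (2 * n)))//.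
  by rewrite ler_wpM2r ?ler_norm// invr_ge0 exprn_ge0// ltW.
rewrite ler_wpM2l// prodfV lef_pV2 ?posrE ?exprn_gt0//; last first.
  by apply: prodr_gt0 => i _; rewrite ltr_pwDl// sqr_ge0.
rewrite exprM -[X in _ ^+ X]card_ord -prodr_const.
apply: ler_prod => i _; rewrite addr_ge0 ?sqr_ge0//=.
have : (k ord0 i)%:~R ^+ 2 <= enorm k ^+ 2 :> R.
  rewrite sqr_sqrtr; last by apply: sumr_ge0 => j _; exact: sqr_ge0.
  by rewrite (bigD1 i)//= lerDl sumr_ge0// => j _; exact: sqr_ge0.
by rewrite sqrrD expr1n mul1r => h; rewrite (le_trans (lerD (lexx 1) h))// lerD2r lerDl mulrn_wge0.
Qed.
End Decay.

(** * Exchange of sums and integrals *)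

Section IntegralOfSum.
Context d (T : measurableType d) (R : realType) (mu : {measure set T -> \bar R}).
Context (I : countType).

(** Limits along finite sets become limits of sequences, as measurability of a
    pointwise limit requires. *)
Lemma fset_exhaustion : exists A_ : nat -> {fset I},
  A_ @ \oo --> @summability.totally I.
Proof.
exists (fun n => [fset i in pmap (@pickle_inv I) (iota 0 n)]%fset).
move=> P [B _ BP].
exists (\max_(i <- B) choice.pickle i).+1 => // n /= Bn; apply: BP => /=.
apply/fsubsetP => i iB; rewrite !inE mem_pmap; apply/mapP.
exists (choice.pickle i); last by rewrite pickleK_inv.
rewrite mem_iota add0n leq0n/=; apply: leq_trans Bn; rewrite ltnS.
exact: (@leq_bigmax_seq _ (enum_fset B) xpredT (@choice.pickle I) i iB isT).
Qed.

Lemma measurable_rsum (x : I -> T -> R) :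
  (forall k, measurable_fun setT (x k)) -> (forall w, rsummable (x^~ w)) ->
  measurable_fun setT (fun w => rsum (x^~ w)).
Proof.
move=> mx sx; have [A_ AT] := fset_exhaustion.
apply: (@measurable_fun_cvg _ _ _ _ (fun n w => \sum_(i <- A_ n) x i w)).
  by move=> n; exact: measurable_sum.
move=> w _; have := cvg_comp _ _ AT (cvg_rsum (sx w)).
rewrite (_ : _ \o A_ = (fun n => \sum_(i <- A_ n) x i w))//.
by apply/funext => n /=; rewrite partial_sumE.
Qed.

Lemma integrable_mul_bounded (b phi : T -> R) (C : R) :
  mu.-integrable setT (EFin \o b) -> measurable_fun setT phi ->
  (forall w, `|phi w| <= C) -> mu.-integrable setT (EFin \o (fun w => b w * phi w)).
Proof.
move=> ib mphi phiC.
have mb : measurable_fun setT b by apply/measurable_EFinP; exact: measurable_int ib.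
apply: (@le_integrable _ _ _ _ _ measurableT _ (fun w => C%:E * (EFin \o b) w)%E).
- by apply/measurable_EFinP; exact: measurable_funM.
- move=> w _ /=; rewrite lee_fin !normrM mulrC ler_wpM2r//.
  by rewrite (le_trans (phiC w))// ler_norm.
- exact: integrableZl.
Qed.

Lemma le_norm_integral_mul (b phi : T -> R) (C : R) :
  mu.-integrable setT (EFin \o b) -> measurable_fun setT phi ->
  (forall w, `|phi w| <= C) ->
  `|\int[mu]_w (b w * phi w)| <= C * \int[mu]_w `|b w|.
Proof.
move=> ib mphi phiC.
have i1 := integrable_mul_bounded ib mphi phiC.
have ib' : mu.-integrable setT (EFin \o (fun w => `|b w|)).
  exact: integrable_abse ib.
apply: le_trans (le_normr_Rintegral measurableT i1) _.
rewrite -RintegralZl//; apply: le_Rintegral => //.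
- exact: integrable_abse i1.
- exact: (integrableZl measurableT C ib').
- by move=> w _; rewrite normrM mulrC ler_wpM2r.
Qed.

Lemma rsummable_integral (b : T -> R) (x : I -> T -> R) (y : I -> R) :
  mu.-integrable setT (EFin \o b) -> (forall k, measurable_fun setT (x k)) ->
  (forall k w, `|x k w| <= y k) -> rsummable y ->
  rsummable (fun k => \int[mu]_w (b w * x k w)).
Proof.
move=> ib mx xy sy.
apply: rsummable_le (rsummableZ (\int[mu]_w `|b w|) sy) => k.
by rewrite mulrC; exact: le_norm_integral_mul.
Qed.

(** The truncation error of the sum is bounded uniformly in the point, so that
    integrability of the common factor is all that the exchange takes. *)
Lemma integral_rsum (b : T -> R) (x : I -> T -> R) (y : I -> R) :
  mu.-integrable setT (EFin \o b) -> (forall k, measurable_fun setT (x k)) ->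
  (forall k w, `|x k w| <= y k) -> rsummable y ->
  \int[mu]_w (b w * rsum (x^~ w)) = rsum (fun k => \int[mu]_w (b w * x k w)).
Proof.
move=> ib mx xy sy.
have sx w : rsummable (x^~ w) by apply: rsummable_le sy => k.
have mrs := measurable_rsum mx sx.
apply/esym/cvg_is_rsum/cvgrPdist_le => e e0.
have [B B0] : exists B : R, \int[mu]_w `|b w| < B by exists (\int[mu]_w `|b w| + 1); rewrite ltrDl.
have ib0 : 0 <= \int[mu]_w `|b w| by apply: Rintegral_ge0.
have Bpos : 0 < B by exact: le_lt_trans B0.
have := cvg_rsum sy => /cvgrPdist_le /(_ _ (divr_gt0 e0 Bpos)) [A _ AP].
exists A => // D /AP; rewrite !partial_sumE => yD.
have y0 k : 0 <= y k by rewrite (le_trans _ (xy k point)).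
rewrite ger0_norm in yD; last by rewrite subr_ge0 sum_fset_le_rsum.
have -> : \sum_(i <- D) \int[mu]_w (b w * x i w) =
    \int[mu]_w (b w * \sum_(i <- D) x i w).
  elim: (D : seq I) => [|i s IH].
    by rewrite big_nil; under eq_Rintegral do rewrite big_nil mulr0;
      rewrite Rintegral_cst// mul0r.
  rewrite big_cons IH -RintegralD//.
  - by apply: eq_Rintegral => w _; rewrite big_cons mulrDr.
  - exact: integrable_mul_bounded (xy i).
  - apply: (@integrable_mul_bounded _ _ (\sum_(i <- s) y i)) => //.
      exact: measurable_sum.
    by move=> w; rewrite (le_trans (ler_norm_sum _ _ _))// ler_sum.
rewrite -RintegralB//; last 2 first.
- apply: (@integrable_mul_bounded _ _ (rsum y)) => // w.
  exact: ler_norm_rsum.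
- apply: (@integrable_mul_bounded _ _ (\sum_(i <- D) y i)) => //.
    exact: measurable_sum.
  by move=> w; rewrite (le_trans (ler_norm_sum _ _ _))// ler_sum.
under eq_Rintegral do rewrite -mulrBr.
apply: le_trans (@le_norm_integral_mul _ _ (e / B) ib _ _) _.
- by apply: measurable_funB => //; exact: measurable_sum.
- move=> w; apply: le_trans yD; exact: rsum_tail.
- by rewrite mulrAC ler_pdivrMr// ler_wpM2l ?ltW.
Qed.

End IntegralOfSum.

Section ComplexIntegrals.
Context {R : realType} {n : nat}.
Local Notation "z ^*" := (conjc z) : ring_scope.
Local Notation mu := (haar R n).
Implicit Types (F G b : torus R n -> R[i]).

Lemma cmeasurable_cst (c : R[i]) : cmeasurable (fun _ : torus R n => c).
Proof. by split; exact: measurable_cst. Qed.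

Lemma cmeasurableD F G : cmeasurable F -> cmeasurable G ->
  cmeasurable (fun w => F w + G w).
Proof.
move=> [F1 F2] [G1 G2]; split.
  rewrite (_ : (fun w => _) = (fun w => complex.Re (F w) + complex.Re (G w))).
    exact: measurable_funD.
  by apply/funext => w; rewrite ReD.
rewrite (_ : (fun w => _) = (fun w => complex.Im (F w) + complex.Im (G w))).
  exact: measurable_funD.
by apply/funext => w; rewrite ImD.
Qed.

Lemma cmeasurableM F G : cmeasurable F -> cmeasurable G ->
  cmeasurable (fun w => F w * G w).
Proof.
move=> [F1 F2] [G1 G2]; split.
  rewrite (_ : (fun w => _) = (fun w => complex.Re (F w) * complex.Re (G w)
    - complex.Im (F w) * complex.Im (G w))).
    by apply: measurable_funB; exact: measurable_funM.
  by apply/funext => w; rewrite ReM.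
rewrite (_ : (fun w => _) = (fun w => complex.Re (F w) * complex.Im (G w)
  + complex.Im (F w) * complex.Re (G w))).
  by apply: measurable_funD; exact: measurable_funM.
by apply/funext => w; rewrite ImM.
Qed.

Lemma cmeasurableN F : cmeasurable F -> cmeasurable (fun w => - F w).
Proof.
move=> mF; rewrite (_ : (fun w => _) = (fun w => -1 * F w)).
  by apply: cmeasurableM => //; exact: cmeasurable_cst.
by apply/funext => w; rewrite mulN1r.
Qed.

Lemma cmeasurableB F G : cmeasurable F -> cmeasurable G ->
  cmeasurable (fun w => F w - G w).
Proof. by move=> mF mG; apply: cmeasurableD => //; exact: cmeasurableN. Qed.

Lemma cmeasurableJ F : cmeasurable F -> cmeasurable (fun w => (F w)^*).
Proof.
move=> [F1 F2]; split.
  by rewrite (_ : (fun w => _) = (fun w => complex.Re (F w)))//;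
    apply/funext => w; rewrite ReJ.
rewrite (_ : (fun w => _) = (fun w => - complex.Im (F w))).
  exact: measurable_funN.
by apply/funext => w; rewrite ImJ.
Qed.

Lemma cmeasurable_sum (I : Type) (s : seq I) (F_ : I -> torus R n -> R[i]) :
  (forall i, cmeasurable (F_ i)) -> cmeasurable (fun w => \sum_(i <- s) F_ i w).
Proof.
move=> mF; elim: s => [|i s IH].
  under eq_fun do rewrite big_nil; exact: cmeasurable_cst.
by under eq_fun do rewrite big_cons; exact: cmeasurableD.
Qed.

Lemma cmeasurable_gsum (I : countType) (F_ : I -> torus R n -> R[i]) :
  (forall i, cmeasurable (F_ i)) -> (forall w, csummable (F_^~ w)) ->
  cmeasurable (fun w => gsum (F_^~ w)).
Proof.
move=> mF sF; split => /=; apply: measurable_rsum.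
- by move=> k; have [] := mF k.
- by move=> w; exact: csummable_Re.
- by move=> k; have [] := mF k.
- by move=> w; exact: csummable_Im.
Qed.

Lemma measurable_dot (k : Zn n) : measurable_fun setT (fun w : torus R n => dot k w).
Proof.
apply: measurable_sum => i; apply: measurable_funM; first exact: measurable_cst.
exact: measurable_tnth.
Qed.

Lemma cmeasurable_cexp2pi (t : torus R n -> R) : measurable_fun setT t ->
  cmeasurable (fun w => cexp2pi (t w)).
Proof.
move=> mt; split.
  apply: (@measurableT_comp _ _ _ _ _ _ (fun x => cos (2 * pi * x))) => //.
  apply: continuous_measurable_fun => x; apply: continuous_comp.
    by apply: cvgMr; exact: cvg_id.
  exact: continuous_cos.
apply: (@measurableT_comp _ _ _ _ _ _ (fun x => sin (2 * pi * x))) => //.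
apply: continuous_measurable_fun => x; apply: continuous_comp.
  by apply: cvgMr; exact: cvg_id.
exact: continuous_sin.
Qed.

Lemma measurable_cabs F : cmeasurable F -> measurable_fun setT (fun w => cabs (F w)).
Proof.
move=> [F1 F2].
rewrite (_ : (fun w => _) =
  (fun w => Num.sqrt (complex.Re (F w) ^+ 2 + complex.Im (F w) ^+ 2))).
  apply: (@measurableT_comp _ _ _ _ _ _ (@Num.sqrt R)).
    apply: continuous_measurable_fun; exact: sqrt_continuous.
  by apply: measurable_funD; exact: measurable_funX.
by apply/funext => w; case: (F w).
Qed.

Definition cintegrable b : Prop :=
  mu.-integrable setT (EFin \o (fun w => complex.Re (b w))) /\
  mu.-integrable setT (EFin \o (fun w => complex.Im (b w))).

Lemma cintegrable_cmeasurable b : cintegrable b -> cmeasurable b.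
Proof.
by move=> [b1 b2]; split; apply/measurable_EFinP; [exact: measurable_int b1|
  exact: measurable_int b2].
Qed.

(** The real and imaginary parts of the product are differences and sums of real
    products, to each of which [integral_rsum] applies. *)
Lemma cint_gsum (I : countType) b (F_ : I -> torus R n -> R[i]) (y : I -> R) :
  cintegrable b -> (forall k, cmeasurable (F_ k)) ->
  (forall k w, cabs (F_ k w) <= y k) -> rsummable y ->
  cint (fun w => b w * gsum (F_^~ w)) = gsum (fun k => cint (fun w => b w * F_ k w)).
Proof.
move=> [bR bI] mF Fy sy.
have mR k : measurable_fun setT (fun w => complex.Re (F_ k w)) by have [] := mF k.
have mI k : measurable_fun setT (fun w => complex.Im (F_ k w)) by have [] := mF k.
have yR k w : `|complex.Re (F_ k w)| <= y k by rewrite (le_trans (ler_Re_cabs _)).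
have yI k w : `|complex.Im (F_ k w)| <= y k by rewrite (le_trans (ler_Im_cabs _)).
have sR w : rsummable (fun k => complex.Re (F_ k w)) by apply: rsummable_le sy.
have sI w : rsummable (fun k => complex.Im (F_ k w)) by apply: rsummable_le sy.
have iE (c : torus R n -> R) (x : I -> torus R n -> R) :
    mu.-integrable setT (EFin \o c) -> (forall k, measurable_fun setT (x k)) ->
    (forall k w, `|x k w| <= y k) ->
    mu.-integrable setT (EFin \o (fun w => c w * rsum (x^~ w))).
  move=> ic mx xy; apply: (@integrable_mul_bounded _ _ _ _ _ _ (rsum y)) => //.
    by apply: measurable_rsum => // w; apply: rsummable_le sy.
  by move=> w; exact: ler_norm_rsum.
have iE' (c : torus R n -> R) (x : torus R n -> R) k :
    mu.-integrable setT (EFin \o c) -> measurable_fun setT x ->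
    (forall w, `|x w| <= y k) ->
    mu.-integrable setT (EFin \o (fun w => c w * x w)).
  by move=> ic mx xy; exact: (@integrable_mul_bounded _ _ _ _ _ _ (y k)).
apply: complex_ext => /=.
- under eq_Rintegral do rewrite ReM /=.
  rewrite RintegralB//; [|exact: iE|exact: iE].
  rewrite (integral_rsum bR mR yR sy) (integral_rsum bI mI yI sy).
  rewrite -rsumB; [|exact: rsummable_integral yR sy|exact: rsummable_integral yI sy].
  apply: eq_rsum => k; rewrite -RintegralB//; [|exact: iE' (yR k)|exact: iE' (yI k)].
  by apply: eq_Rintegral => w _; rewrite ReM.
- under eq_Rintegral do rewrite ImM /=.
  rewrite RintegralD//; [|exact: iE|exact: iE].
  rewrite (integral_rsum bR mI yI sy) (integral_rsum bI mR yR sy).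
  rewrite -rsumD; [|exact: rsummable_integral yI sy|exact: rsummable_integral yR sy].
  apply: eq_rsum => k; rewrite -RintegralD//; [|exact: iE' (yI k)|exact: iE' (yR k)].
  by apply: eq_Rintegral => w _; rewrite ImM.
Qed.

Lemma cintegrable_mul_bounded b F (C : R) : cintegrable b -> cmeasurable F ->
  (forall w, cabs (F w) <= C) -> cintegrable (fun w => b w * F w).
Proof.
move=> [bR bI] [FR FI] FC.
have CR w : `|complex.Re (F w)| <= C by rewrite (le_trans (ler_Re_cabs _)).
have CI w : `|complex.Im (F w)| <= C by rewrite (le_trans (ler_Im_cabs _)).
split.
  rewrite (_ : (fun w => _) = (fun w => complex.Re (b w) * complex.Re (F w)
    - complex.Im (b w) * complex.Im (F w))).
    have := integrableB measurableT (integrable_mul_bounded bR FR CR)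
      (integrable_mul_bounded bI FI CI).
    by congr (_.-integrable _ _).
  by apply/funext => w; rewrite ReM.
rewrite (_ : (fun w => _) = (fun w => complex.Re (b w) * complex.Im (F w)
  + complex.Im (b w) * complex.Re (F w))).
  have := integrableD measurableT (integrable_mul_bounded bR FI CI)
    (integrable_mul_bounded bI FR CR).
  by congr (_.-integrable _ _).
by apply/funext => w; rewrite ImM.
Qed.

Lemma cintZ (c : R[i]) b : cintegrable b ->
  cint (fun w => c * b w) = c * cint b.
Proof.
move=> [bR bI]; apply: complex_ext; rewrite ?ReM ?ImM/=.
- rewrite -!RintegralZl// -RintegralB//; [|exact: integrableZl bR|exact: integrableZl bI].
  by apply: eq_Rintegral => w _; rewrite ReM.
- rewrite -!RintegralZl// -RintegralD//; [|exact: integrableZl bI|exact: integrableZl bR].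
  by apply: eq_Rintegral => w _; rewrite ImM.
Qed.

Lemma integrable_cabs b : cintegrable b ->
  mu.-integrable setT (EFin \o (fun w => cabs (b w))).
Proof.
move=> ib; have [bR bI] := ib.
have := integrableD measurableT (integrable_abse bR) (integrable_abse bI).
apply: le_integrable => //.
  apply/measurable_EFinP. apply: measurable_cabs; exact: cintegrable_cmeasurable.
move=> w _ /=; rewrite lee_fin ger0_norm ?cabs_ge0// ger0_norm ?addr_ge0//.
rewrite -(@ler_pXn2r _ 2)// ?nnegrE ?cabs_ge0 ?addr_ge0// cabs_sqr.
rewrite -(real_normK (num_real (complex.Re _))) -(real_normK (num_real (complex.Im _))).
by rewrite sqrrD lerD2r lerDl mulrn_wge0 ?mulr_ge0.
Qed.

(** Proved for the real part of every rotation of the integral. *)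
Lemma ler_cabs_cint b : cintegrable b -> cabs (cint b) <= \int[mu]_w cabs (b w).
Proof.
move=> ib; apply: cabs_le_rotation => c c1; rewrite -cintZ//=.
apply: le_Rintegral => //; last 2 first.
- exact: integrable_cabs.
- by move=> w _; rewrite (le_trans (ler_norm _))// (le_trans (ler_Re_cabs _))// cabsM c1 mul1r.
have [] := @cintegrable_mul_bounded b (fun=> c) 1 ib (cmeasurable_cst c) _.
  by move=> _; rewrite c1.
move=> + _; congr (_.-integrable _ _).
by apply/funext => w /=; rewrite mulrC.
Qed.

Lemma ler_cabs_cint_mul b F : cintegrable b -> cmeasurable F ->
  (forall w, cabs (F w) <= 1) ->
  cabs (cint (fun w => b w * F w)) <= \int[mu]_w cabs (b w).
Proof.
move=> ib mF F1; have ibF := cintegrable_mul_bounded ib mF F1.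
apply: le_trans (ler_cabs_cint ibF) _; apply: le_Rintegral => //.
- exact: integrable_cabs.
- exact: integrable_cabs.
- by move=> w _; rewrite cabsM ler_piMr// cabs_ge0.
Qed.

(** The Haar measure is finite, so an essential bound on the modulus gives
    integrability. *)
Lemma in_Ly_cintegrable b : in_Lp +oo%E b -> cintegrable b.
Proof.
move=> [mb]; rewrite /normLp unlock.
rewrite /= probability_setT lte01.
rewrite (_ : _ \o _ = EFin \o (fun w => cabs (b w))); last first.
  by apply/funext => w /=; rewrite ger0_norm ?cabs_ge0.
move=> /ess_supr_bounded [M bM].
have icabs : mu.-integrable setT (EFin \o (fun w => cabs (b w))).
  have mc : measurable_fun setT (EFin \o (fun w => cabs (b w))).
    by apply/measurable_EFinP; exact: measurable_cabs.
  apply/integrableP; split=> //.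
  apply: (@le_lt_trans _ _ (\int[mu]_w (`|M|%:E))%E); last first.
    by rewrite integral_cst//= probability_setT mule1 ltry.
  apply: ae_ge0_le_integral => //.
  - exact: measurableT_comp.
  - apply: filterS bM => w bw _ /=.
    by rewrite lee_fin ger0_norm ?cabs_ge0// (le_trans bw)// ler_norm.
split; apply: le_integrable icabs => //.
- by apply/measurable_EFinP; have [] := mb.
- by move=> w _ /=; rewrite lee_fin (ger0_norm (cabs_ge0 _)) ler_Re_cabs.
- by apply/measurable_EFinP; have [] := mb.
- by move=> w _ /=; rewrite lee_fin (ger0_norm (cabs_ge0 _)) ler_Im_cabs.
Qed.

End ComplexIntegrals.

(** * Orthogonality of characters *)

Section Orthogonality.
Context {R : realType}.

Lemma sin_period (j : int) (b : R) : sin (2 * pi * j%:~R + b) = sin b.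
Proof.
have nat_case (m : nat) (c : R) : sin (2 * pi * m%:R + c) = sin c.
  by rewrite addrC mulr_natr mulr_natl (periodicn (@sinD2pi R)).
case: j => m; first exact: nat_case.
by rewrite NegzE mulrNz mulrN -(nat_case m.+1 (_ + _)) addrA addrN add0r.
Qed.

(** The fundamental theorem of calculus for the primitive
    [x + sin (a * x + b) / a]. *)
Lemma integral_1Dcos_itv (a b : R) : a != 0 -> sin (a + b) = sin b ->
  (\int[lebesgue_measure]_(x in `[0%R, 1%R]) (1 + cos (a * x + b))%:E = 1)%E.
Proof.
move=> a0 sab.
pose F (x : R) : R := x + a^-1 * sin (a * x + b).
have dF (x : R) : is_derive x 1 F (1 + cos (a * x + b)).
  have d1 : is_derive x 1 (fun x : R => a * x + b) a.
    by apply: is_derive_eq; rewrite /GRing.scale/= mulr1 ?addr0.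
  have d2 := @is_derive1_comp R sin (fun x => a * x + b) x _ _ (is_derive_sin _) d1.
  have d3 : is_derive x 1 (a^-1 *: (sin \o (fun x : R => a * x + b))) (cos (a * x + b)).
    by apply: is_derive_eq; rewrite /GRing.scale/= mulrCA mulVf ?mulr1.
  exact: is_deriveD.
have cF : continuous F.
  by move=> x; apply/differentiable_continuous/derivable1_diffP; have [] := dF x.
have dFE x : F^`()%classic x = 1 + cos (a * x + b).
  by rewrite derive1E; exact: derive_val.
rewrite (@continuous_FTC2 _ _ F)//.
- by rewrite /F mulr1 mulr0 add0r add0r sab -EFinB addrK.
- apply: continuous_subspaceT => x; apply: cvgD; first exact: cvg_cst.
  apply: (@continuous_comp _ _ _ (fun x : R => a * x + b) cos).
    by apply: cvgD; [apply: cvgMr; exact: cvg_id|exact: cvg_cst].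
  exact: continuous_cos.
- split.
  + by move=> x _; have [] := dF x.
  + exact/cvg_at_right_filter/cF.
  + exact/cvg_at_left_filter/cF.
Qed.

Lemma measurable_1Dcos d (T : measurableType d) (f : T -> R) :
  measurable_fun setT f ->
  measurable_fun setT (fun x => (1 + cos (2 * pi * f x))%:E).
Proof.
move=> mf; apply/measurable_EFinP; apply: measurable_funD => //.
apply: (@measurableT_comp _ _ _ _ _ _ (fun x => cos (2 * pi * x))) => //.
apply: continuous_measurable_fun => x; apply: continuous_comp.
  by apply: cvgMr; exact: cvg_id.
exact: continuous_cos.
Qed.

Lemma ge0_1Dcos (x : R) : (0 <= (1 + cos x)%:E)%E.
Proof. by rewrite lee_fin addrC -lerBlDr sub0r cos_geN1. Qed.

(** Adding 1 makes the integrand nonnegative, so that Tonelli's theorem peels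
    off the coordinates of the torus one at a time. *)
Lemma integral_1Dcos_haar n (j : Zn n) (c : R) : j != 0 ->
  (\int[haar R n]_w (1 + cos (2 * pi * (dot j w + c)))%:E = 1)%E.
Proof.
elim: n j c => [|n IH] j c j0.
  by rewrite (thinmx0 j) eqxx in j0.
have mdot m (k : Zn m) c' :
    measurable_fun setT (fun w : torus R m => dot k w + c').
  by apply: measurable_funD => //; exact: measurable_dot.
have mcons : measurable_fun [set: (measurableTypeR R * torus R n)%type]
  (@cons_torus R n) by exact: measurable_cons_torus.
have pf := ge0_integral_pushforward mcons
  [the measure _ _ of (uniform_prob (@ltr01 R) \x haar R n)%E] measurableT
  (measurable_1Dcos (mdot _ j c)) (fun w _ => ge0_1Dcos _).
apply: (etrans _ (etrans pf _)); first exact: eq_measure_integral.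
rewrite preimage_setT (fubini_tonelli2 (m1 := uniform_prob (@ltr01 R)) (m2 := haar R n));
  last 2 first.
- exact: (measurableT_comp (measurable_1Dcos (mdot _ j c)) mcons).
- by move=> w; exact: ge0_1Dcos.
pose j0' := j ord0 ord0; pose j' : Zn n := \row_i j ord0 (lift ord0 i).
have dotE x t : dot j (cons_torus (x, t)) = j0'%:~R * x + dot j' t.
  rewrite /dot big_ord_recl; congr (_ * _ + _).
  apply: eq_bigr => i _; rewrite mxE; congr (_ * _).
  by rewrite /cons_torus/= tnthS.
rewrite /fubini_G /=.
have [j00|j00] := eqVneq j0' 0.
  have j'0 : j' != 0.
    apply: contra j0 => /eqP j'0; apply/eqP/rowP => i; rewrite mxE.
    case: (unliftP ord0 i) => [k ->|->] //.
    by have /rowP/(_ k) := j'0; rewrite !mxE.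
  rewrite -[RHS](IH j' c j'0); apply: eq_integral => t _.
  under eq_integral do rewrite dotE j00 mul0r add0r.
  by rewrite integral_cst//= probability_setT mule1.
rewrite (eq_integral (fun=> 1%E)) => [|t _].
  by rewrite integral_cst//= probability_setT mule1.
have mg : measurable_fun [set: R]
    (fun x : R => (1 + cos (2 * pi * (dot j (cons_torus (x, t)) + c)))%:E).
  apply: measurable_1Dcos; apply: measurable_funD => //.
  under eq_fun do rewrite dotE.
  by apply: measurable_funD => //; exact: measurable_funM.
rewrite (integral_uniform _ mg); last by move=> x; exact: ge0_1Dcos.
rewrite subr0 invr1 mul1e.
under eq_integral do rewrite dotE -addrA mulrDr mulrA.
apply: integral_1Dcos_itv; last exact: sin_period.
by rewrite mulf_neq0 ?intr_eq0// mulf_neq0// gt_eqF// pi_gt0.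
Qed.

Lemma integral_cos_haar n (j : Zn n) (c : R) : j != 0 ->
  \int[haar R n]_w cos (2 * pi * (dot j w + c)) = 0.
Proof.
move=> j0; have := integral_1Dcos_haar c j0.
have icos : (haar R n).-integrable setT
    (EFin \o (fun w => cos (2 * pi * (dot j w + c)))).
  have i1 : (haar R n).-integrable setT (EFin \o (fun=> 1 : R)).
    by apply: finite_measure_integrable_cst.
  have mc : measurable_fun setT (fun w : torus R n => cos (2 * pi * (dot j w + c))).
    apply: (@measurableT_comp _ _ _ _ _ _ (fun x => cos (2 * pi * x))).
      apply: continuous_measurable_fun => x; apply: continuous_comp.
        by apply: cvgMr; exact: cvg_id.
      exact: continuous_cos.
    by apply: measurable_funD => //; exact: measurable_dot.
  have := integrable_mul_bounded i1 mc (C := 1).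
  under eq_fun do rewrite mul1r.
  by apply => w; rewrite ler_norml cos_geN1 cos_le1.
move/(congr1 fine); rewrite -/(Rintegral _ _ _) RintegralD//=.
  rewrite Rintegral_cst//= probability_setT mulr1 => h.
  by apply: (addrI (1 : R)); rewrite addr0.
by apply: finite_measure_integrable_cst.
Qed.

(** The imaginary part is reduced to the real one by a quarter-period shift. *)
Lemma cint_cexp2pi n (j : Zn n) :
  cint (fun w : torus R n => cexp2pi (dot j w)) = (j == 0)%:R.
Proof.
have [->|j0] := eqVneq j 0.
  rewrite /cint; under eq_Rintegral do rewrite dot0 cexp2pi0.
  under [X in _ +i* X]eq_Rintegral do rewrite dot0 cexp2pi0.
  by rewrite !Rintegral_cst//= probability_setT mulr1 mul0r.
apply: complex_ext => /=.
  by rewrite -[RHS](integral_cos_haar 0 j0); apply: eq_Rintegral => w _; rewrite addr0.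
rewrite -[RHS](integral_cos_haar (- 4^-1) j0); apply: eq_Rintegral => w _.
rewrite -cosBpihalf; congr cos; by field.
Qed.

End Orthogonality.

(** * Square integrals and Parseval's identity *)

Section CintSum.
Context {R : realType} {n : nat}.
Local Notation mu := (haar R n).
Implicit Types (F G : torus R n -> R[i]).

Lemma cintegrableD F G : cintegrable F -> cintegrable G ->
  cintegrable (fun w => F w + G w).
Proof.
move=> [F1 F2] [G1 G2]; split.
  have := integrableD measurableT F1 G1; congr (_.-integrable _ _).
  by apply/funext => w /=; rewrite ReD.
have := integrableD measurableT F2 G2; congr (_.-integrable _ _).
by apply/funext => w /=; rewrite ImD.
Qed.

Lemma cintD F G : cintegrable F -> cintegrable G ->
  cint (fun w => F w + G w) = cint F + cint G.
Proof.
move=> [F1 F2] [G1 G2]; apply: complex_ext => /=.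
  by rewrite -RintegralD//; apply: eq_Rintegral => w _; rewrite ReD.
by rewrite -RintegralD//; apply: eq_Rintegral => w _; rewrite ImD.
Qed.

Lemma cintegrable_bounded F (C : R) : cmeasurable F -> (forall w, cabs (F w) <= C) ->
  cintegrable F.
Proof.
move=> mF FC.
have i1 : cintegrable (fun _ : torus R n => 1 : R[i]).
  by split; apply: finite_measure_integrable_cst.
have := cintegrable_mul_bounded i1 mF FC.
by under eq_fun do rewrite mul1r.
Qed.

Lemma cint_sum (I : Type) (s : seq I) (F_ : I -> torus R n -> R[i]) :
  (forall i, cintegrable (F_ i)) ->
  cint (fun w => \sum_(i <- s) F_ i w) = \sum_(i <- s) cint (F_ i).
Proof.
move=> iF.
have is_ (r : seq I) : cintegrable (fun w => \sum_(i <- r) F_ i w).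
  elim: r => [|i r IH].
    under eq_fun do rewrite big_nil.
    apply: (@cintegrable_bounded _ 0); first exact: cmeasurable_cst.
    by move=> _; rewrite ComplexField.Normc.normc0.
  by under eq_fun do rewrite big_cons; exact: cintegrableD.
elim: s => [|i s IH].
  rewrite big_nil; apply: complex_ext => /=; under eq_Rintegral do rewrite big_nil;
    by rewrite Rintegral_cst// mul0r.
rewrite big_cons -IH -cintD//.
by congr cint; apply/funext => w; rewrite big_cons.
Qed.

End CintSum.

Section SquareIntegral.
Context {R : realType} {n : nat}.
Local Notation "z ^*" := (conjc z) : ring_scope.
Local Notation mu := (haar R n).
Implicit Types (F G : torus R n -> R[i]) (A B : {fset Zn n}) (c : Zn n -> R[i]).

Definition sqint F : \bar R := (\int[mu]_w ((cabs (F w)) ^+ 2)%:E)%E.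

Definition trig A c : torus R n -> R[i] :=
  fun w => \sum_(k <- A) cexp2pi (- dot k w) * c k.

Lemma measurable_cabs_sqr F : cmeasurable F ->
  measurable_fun setT (fun w => ((cabs (F w)) ^+ 2)%:E).
Proof.
by move=> mF; apply/measurable_EFinP; apply: measurable_funX; exact: measurable_cabs.
Qed.

Lemma sqint_ge0 F : (0 <= sqint F)%E.
Proof. by apply: integral_ge0 => w _; rewrite lee_fin sqr_ge0. Qed.

(** The quasi-triangle inequality [(x + y) ^+ 2 <= 2 x ^+ 2 + 2 y ^+ 2], which is
    as good as Minkowski's inequality for proving convergence. *)
Lemma sqintD F G : cmeasurable F -> cmeasurable G ->
  (sqint (fun w => (F w + G w)%R) <= 2%:E * sqint F + 2%:E * sqint G)%E.
Proof.
move=> mF mG; have mF2 := measurable_cabs_sqr mF; have mG2 := measurable_cabs_sqr mG.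
rewrite /sqint -!ge0_integralZl//; last 2 first.
- by move=> w _; rewrite lee_fin sqr_ge0.
- by move=> w _; rewrite lee_fin sqr_ge0.
rewrite -ge0_integralD//; last 4 first.
- by move=> w _; rewrite -EFinM lee_fin mulr_ge0 ?sqr_ge0.
- by apply: measurable_funeM.
- by move=> w _; rewrite -EFinM lee_fin mulr_ge0 ?sqr_ge0.
- by apply: measurable_funeM.
apply: ge0_le_integral => //.
- by move=> w _; rewrite lee_fin sqr_ge0.
- by apply: measurable_cabs_sqr; exact: cmeasurableD.
- by apply: emeasurable_funD; apply: measurable_funeM.
move=> w _; rewrite -!EFinM -EFinD lee_fin.
have h := ler_cabsD (F w) (G w); have h0 := cabs_ge0 (F w + G w).
apply: (@le_trans _ _ ((cabs (F w) + cabs (G w)) ^+ 2)).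
  by rewrite ler_pXn2r// nnegrE addr_ge0 ?cabs_ge0.
rewrite -subr_ge0 (_ : _ - _ = (cabs (F w) - cabs (G w)) ^+ 2) ?sqr_ge0//.
by ring.
Qed.

Lemma sqintM_le F G (C : R) : cmeasurable F -> cmeasurable G -> 0 <= C ->
  (forall w, cabs (F w) <= C * cabs (G w)) ->
  (sqint F <= (C ^+ 2)%:E * sqint G)%E.
Proof.
move=> mF mG C0 FG.
rewrite /sqint -ge0_integralZl//; last 3 first.
- exact: measurable_cabs_sqr.
- by move=> w _; rewrite lee_fin sqr_ge0.
- by rewrite lee_fin sqr_ge0.
apply: ge0_le_integral => //.
- by move=> w _; rewrite lee_fin sqr_ge0.
- exact: measurable_cabs_sqr.
- by apply: measurable_funeM; exact: measurable_cabs_sqr.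
- move=> w _; rewrite -EFinM lee_fin -exprMn.
  by rewrite ler_pXn2r// nnegrE ?cabs_ge0// mulr_ge0// cabs_ge0.
Qed.

Lemma sqint_le_bound F (C : R) : cmeasurable F -> 0 <= C ->
  (forall w, cabs (F w) <= C) -> (sqint F <= (C ^+ 2)%:E)%E.
Proof.
move=> mF C0 FC; have m1 := @cmeasurable_cst R n 1.
have F1 w : cabs (F w) <= C * cabs (1 : R[i]).
  by rewrite ComplexField.Normc.normc1 mulr1.
apply: le_trans (sqintM_le mF m1 C0 F1) _.
rewrite /sqint ComplexField.Normc.normc1 integral_cst//= probability_setT.
by rewrite expr1n mul1e mule1.
Qed.

Lemma sqintC F G : sqint (fun w => F w - G w) = sqint (fun w => G w - F w).
Proof. by apply: eq_integral => w _; rewrite -opprB cabsN. Qed.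

Lemma sqint_eq0_ae F : cmeasurable F -> sqint F = 0%E ->
  {ae mu, forall w, F w = 0}.
Proof.
move=> mF F0; have := @ae_eq_integral_abs _ _ _ mu _ measurableT _ (measurable_cabs_sqr mF).
move=> [+ _].
under eq_integral do rewrite gee0_abs ?lee_fin ?sqr_ge0//.
move=> /(_ F0); apply: filterS => w /(_ I) [] /eqP; rewrite sqrf_eq0 => /eqP.
exact: ComplexField.Normc.eq0_normc.
Qed.

Lemma eq_ae_sqint F G : cmeasurable F -> cmeasurable G ->
  {ae mu, forall w, F w = G w} -> sqint F = sqint G.
Proof.
move=> mF mG FG; apply: ge0_ae_eq_integral => //.
- exact: measurable_cabs_sqr.
- exact: measurable_cabs_sqr.
- by move=> w _; rewrite lee_fin sqr_ge0.
- by move=> w _; rewrite lee_fin sqr_ge0.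
- by apply: filterS FG => w ->.
Qed.

Lemma cmeasurable_char k : cmeasurable (fun w : torus R n => cexp2pi (dot k w)).
Proof. by apply: cmeasurable_cexp2pi; exact: measurable_dot. Qed.

Lemma cmeasurable_charN k : cmeasurable (fun w : torus R n => cexp2pi (- dot k w)).
Proof. by under eq_fun do rewrite -dotN; exact: cmeasurable_char. Qed.

Lemma cmeasurable_trig A c : cmeasurable (trig A c).
Proof.
apply: cmeasurable_sum => k; apply: cmeasurableM; first exact: cmeasurable_charN.
exact: cmeasurable_cst.
Qed.

Lemma trigD A c c' w : trig A (fun k => c k + c' k) w = trig A c w + trig A c' w.
Proof. by rewrite /trig -big_split; apply: eq_bigr => k _; rewrite mulrDr. Qed.

Lemma trigB A c c' w : trig A (fun k => c k - c' k) w = trig A c w - trig A c' w.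
Proof. by rewrite /trig -sumrB; apply: eq_bigr => k _; rewrite mulrBr. Qed.

Lemma cabs_trig_le A c w : cabs (trig A c w) <= \sum_(k <- A) cabs (c k).
Proof.
apply: le_trans (ler_cabs_sum _ _) _; apply: ler_sum => k _.
by rewrite cabsM cabs_cexp2pi mul1r.
Qed.

(** Parseval's identity for trigonometric polynomials: only the diagonal terms of
    the expanded square survive the integration. *)
Lemma sqint_trig A c : sqint (trig A c) = (\sum_(k <- A) cabs (c k) ^+ 2)%:E.
Proof.
have mT := cmeasurable_trig A c.
have mTT : cmeasurable (fun w => trig A c w * (trig A c w)^*).
  by apply: cmeasurableM => //; exact: cmeasurableJ.
pose C := \sum_(k <- A) cabs (c k).
have bTT w : cabs (trig A c w * (trig A c w)^*) <= C * C.
  by rewrite cabsM cabsJ ler_pM ?cabs_ge0 ?cabs_trig_le.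
have iTT := cintegrable_bounded mTT bTT.
have -> : sqint (trig A c) = (complex.Re (cint (fun w => trig A c w * (trig A c w)^*)))%:E.
  rewrite /cint /= /Rintegral fineK; last first.
    by have [i1 _] := iTT; exact: integrable_fin_num i1.
  by apply: eq_integral => w _; rewrite mulCJ.
congr EFin.
have itm k l : cintegrable (fun w : torus R n =>
    cexp2pi (- dot k w) * c k * (cexp2pi (- dot l w) * c l)^*).
  apply: (@cintegrable_bounded _ _ _ (cabs (c k) * cabs (c l))).
    apply: cmeasurableM; last apply: cmeasurableJ.
      by apply: cmeasurableM; [exact: cmeasurable_charN|exact: cmeasurable_cst].
    by apply: cmeasurableM; [exact: cmeasurable_charN|exact: cmeasurable_cst].
  by move=> w; rewrite cabsM cabsJ !cabsM !cabs_cexp2pi !mul1r.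
have isum k : cintegrable (fun w : torus R n =>
    \sum_(l <- A) cexp2pi (- dot k w) * c k * (cexp2pi (- dot l w) * c l)^*).
  elim: (A : seq _) => [|l s IH].
    under eq_fun do rewrite big_nil.
    apply: (@cintegrable_bounded _ _ _ 0); first exact: cmeasurable_cst.
    by move=> _; rewrite ComplexField.Normc.normc0.
  by under eq_fun do rewrite big_cons; exact: cintegrableD.
rewrite (_ : (fun w => _) = (fun w => \sum_(k <- A) \sum_(l <- A)
    cexp2pi (- dot k w) * c k * (cexp2pi (- dot l w) * c l)^*)); last first.
  by apply/funext => w; rewrite /trig rmorph_sum big_distrlr.
rewrite cint_sum// Re_sum; apply: eq_big_seq => k kA.
rewrite cint_sum//.
rewrite (eq_bigr (fun l => (c k * (c l)^*) * (l - k == 0)%:R)) => [|l _]; last first.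
  rewrite -cint_cexp2pi -cintZ; last first.
    apply: (@cintegrable_bounded _ _ _ 1); first exact: cmeasurable_char.
    by move=> w; rewrite cabs_cexp2pi.
  congr cint; apply/funext => w.
  by rewrite conjM cexp2piJ opprK dotB cexp2piD; ring.
rewrite (big_fsetD1 k)//= subrr eqxx mulr1 big1_fset ?addr0.
  by rewrite mulCJ.
by move=> l; rewrite !inE subr_eq0 => /andP[/negbTE -> _] _; rewrite mulr0.
Qed.

Lemma normLp2_le F (e : R) : 0 <= e ->
  ((normLp 2%:E F <= e%:E)%E = (sqint F <= (e ^+ 2)%:E)%E).
Proof.
move=> e0.
have E : ((normLp 2%:E F) `^ 2 = sqint F)%E.
  rewrite /normLp poweR_Lnorm//; apply: eq_integral => w _.
  by rewrite gee0_abs ?lee_fin ?cabs_ge0// poweR_EFin powR_mulrn ?cabs_ge0.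
have : (0 <= normLp 2%:E F)%E by exact: Lnorm_ge0.
move: E; case: (normLp 2%:E F) => [x||]//.
- rewrite poweR_EFin => <-; rewrite !lee_fin => x0.
  by rewrite powR_mulrn// ler_pXn2r.
- by rewrite poweRyr// => <-.
Qed.

Lemma in_L2P F : in_Lp 2%:E F <-> cmeasurable F /\ (sqint F < +oo)%E.
Proof.
rewrite /in_Lp; split=> -[mF Fy]; split=> //.
- have := Lnorm_ge0 mu 2%:E (fun w => (cabs (F w))%:E); rewrite -/(normLp _ F).
  move: Fy; case E : (normLp 2%:E F) => [x||]// _; rewrite lee_fin => x0.
  have : (normLp 2%:E F <= x%:E)%E by rewrite E.
  by rewrite normLp2_le// => h; rewrite (le_lt_trans h)// ltry.
- have F0 := sqint_ge0 F.
  have : (normLp 2%:E F <= (Num.sqrt (fine (sqint F)))%:E)%E.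
    by rewrite normLp2_le ?sqrtr_ge0// sqr_sqrtr ?fine_ge0// fineK// ge0_fin_numE.
  by move=> h; rewrite (le_lt_trans h)// ltry.
Qed.

(** Squared norms avoid roots in all later estimates. *)
Lemma is_fourier_l2P (f : Zn n -> R[i]) F : is_fourier_l2 f F <->
  [/\ cmeasurable F, (sqint F < +oo)%E &
   forall e : R, 0 < e -> \forall A \near @summability.totally (Zn n),
     (sqint (fun w => (F w - trig A f w)%R) <= e%:E)%E].
Proof.
rewrite /is_fourier_l2 in_L2P; split=> [[[mF Fy] c]|[mF Fy c]].
- split=> // e e0.
  have e'0 : 0 < Num.sqrt e by rewrite sqrtr_gt0.
  have /fine_cvgP[fin /cvgrPdist_le/(_ _ e'0)] := c.
  apply: filterS2 fin => A /= fA; rewrite sub0r normrN => h.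
  have e2 : e = Num.sqrt e ^+ 2 by rewrite sqr_sqrtr// ltW.
  rewrite e2 -normLp2_le ?sqrtr_ge0// -[X in (X <= _)%E]fineK// lee_fin.
  by rewrite (le_trans (ler_norm _)).
- split=> //; apply/fine_cvgP; split.
    apply: filterS (c _ ltr01) => A h; rewrite ge0_fin_numE; last exact: Lnorm_ge0.
    apply: (@le_lt_trans _ _ 1%:E); last exact: ltry.
    by rewrite normLp2_le// expr1n.
  apply/cvgrPdist_le => e e0; apply: filterS (c _ (exprn_gt0 2 e0)) => A.
  rewrite -normLp2_le; last exact: ltW.
  move=> h /=.
  have g0 : (0 <= normLp 2%:E (fun w => (F w - trig A f w)%R))%E by exact: Lnorm_ge0.
  rewrite sub0r normrN ger0_norm ?fine_ge0//.
  rewrite -lee_fin fineK// ge0_fin_numE//.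
  by rewrite (le_lt_trans h)// ltry.
Qed.

End SquareIntegral.

(** * Existence of the Fourier transform on l2 *)

Section Sequences.
Context {R : realType}.

Lemma rsummable_cvg_series (e : nat -> R) : (forall i, 0 <= e i) -> rsummable e ->
  cvgn (series e).
Proof.
move=> e0 se; apply: (@summable_cvg _ xpredT (EFin \o e)).
  by move=> i _; rewrite /= lee_fin.
apply: le_lt_trans se; rewrite -nneseries_esumT//.
by rewrite nneseries_esum.
Qed.

Lemma cvg_summable_steps (s e : nat -> R) :
  (forall i, `|s i.+1 - s i| <= e i) -> rsummable e -> cvgn s.
Proof.
move=> se sume.
have e0 i : 0 <= e i by exact: le_trans (se i).
rewrite (_ : s = cst (s 0%N) \+ series (telescope s)); last first.
  by apply/funext => n; rewrite [LHS]eq_sum_telescope.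
apply: is_cvgD; first exact: is_cvg_cst.
apply: normed_cvg; apply: (@series_le_cvg _ _ e) => //.
  by move=> i /=.
exact: rsummable_cvg_series.
Qed.

Lemma rsummable_half_pow : rsummable (fun i : nat => (2^-1 : R) ^+ i).
Proof.
apply: (@rsummable_nat _ _ 2) => [i|N]; first by rewrite exprn_ge0.
rewrite (_ : \sum_(0 <= i < N) _ = 2 - 2 * (2^-1) ^+ N); last first.
  elim: N => [|N IH]; first by rewrite big_geq// expr0 mulr1 subrr.
  by rewrite big_nat_recr//= IH exprS; field.
by rewrite gerBl mulr_ge0// exprn_ge0.
Qed.

Lemma limn_einf_le (u : nat -> \bar R) (c : \bar R) : (forall n, (u n <= c)%E) ->
  (limn_einf u <= c)%E.
Proof.
move=> uc; rewrite limn_einf_lim; apply: lime_le; first exact: is_cvg_einfs.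
apply: nearW => n; apply: le_trans (uc n); apply: ereal_inf_lbound.
by exists n => /=.
Qed.

End Sequences.

Section SquareSummable.
Context {R : realType} {n : nat}.
Local Notation mu := (haar R n).
Local Notation tot := (@summability.totally (Zn n)).
Implicit Types (F G : torus R n -> R[i]) (A B : {fset Zn n}) (f g : Zn n -> R[i]).

Definition sqsummable {I : choiceType} (f : I -> R[i]) : Prop :=
  rsummable (fun k => cabs (f k) ^+ 2).

Lemma in_l2P f : in_l2 f <-> sqsummable f.
Proof.
rewrite /in_l2 /sqsummable /rsummable.
suff -> : (\esum_(k in setT) (cabs (f k) ^+ 2)%:E =
  \esum_(k in setT) `|cabs (f k) ^+ 2|%:E)%E by [].
by apply: eq_esum => k _; rewrite ger0_norm// sqr_ge0.
Qed.

(** Squared l2 norm of [f] off the finite set [A]. *)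
Definition l2tail f A : R :=
  rsum (fun k => cabs (f k) ^+ 2) - \sum_(k <- A) cabs (f k) ^+ 2.

Lemma l2tail_small f (e : R) : sqsummable f -> 0 < e ->
  \forall A \near tot, l2tail f A <= e.
Proof.
move=> sf e0; have /cvgrPdist_le/(_ _ e0) := cvg_rsum sf.
apply: filterS => A; rewrite partial_sumE; apply: le_trans; exact: ler_norm.
Qed.

(** The difference has its coefficients on the symmetric difference of [A] and
    [B]. *)
Lemma sqint_trigB f A B : sqsummable f ->
  (sqint (fun w => (trig A f w - trig B f w)%R) <= (l2tail f A + l2tail f B)%:E)%E.
Proof.
move=> sf.
pose r (D : {fset Zn n}) k : R[i] := if k \in D then f k else 0.
have trE D w : (D `<=` A `|` B)%fset -> trig D f w = trig (A `|` B)%fset (r D) w.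
  move=> /big_fset_sub e; rewrite /trig e; apply: eq_bigr => k _.
  by rewrite /r; case: ifP => // _; rewrite mulr0.
rewrite (_ : (fun w => _) = trig (A `|` B)%fset (fun k => r A k - r B k)); last first.
  by apply/funext => w; rewrite trigB !trE ?fsubsetUl ?fsubsetUr.
rewrite sqint_trig lee_fin.
pose q (D : {fset Zn n}) k := cabs (f k) ^+ 2 - (if k \in D then cabs (f k) ^+ 2 else 0).
apply: (@le_trans _ _ (\sum_(k <- (A `|` B)%fset) (q A k + q B k))).
  apply: ler_sum => k _; rewrite /q /r.
  have := sqr_ge0 (cabs (f k)).
  case: ifP => _; case: ifP => _ h; rewrite ?subrr ?subr0 ?sub0r ?cabsN
    ?ComplexField.Normc.normc0 ?expr0n ?addr0 ?add0r//=.
  by rewrite addr_ge0.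
rewrite big_split !sumrB -!big_fset_sub ?fsubsetUl ?fsubsetUr//.
by rewrite lerD// lerB// sum_fset_le_rsum// => k; rewrite sqr_ge0.
Qed.

(** Almost everywhere convergence along a sequence of finite sets whose tails
    decay geometrically yields the limit; Fatou's lemma bounds its distance to
    all partial sums. *)
Lemma Riesz_Fischer f : sqsummable f -> exists F, is_fourier_l2 f F.
Proof.
move=> sf.
(* The steps below are weighted by 2 ^+ i, so the tails must decay faster than
   (2^-1) ^+ i. *)
have /choice[A_ A_e] : forall i : nat, exists A, l2tail f A <= (4^-1) ^+ i.
  move=> i; have e0 : 0 < (4^-1 : R) ^+ i by rewrite exprn_gt0.
  by have [A ?] := filter_ex (l2tail_small sf e0); exists A.
pose S i := trig (A_ i) f.
have mS i : cmeasurable (S i) by exact: cmeasurable_trig.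
pose d i w : R := cabs (S i.+1 w - S i w) ^+ 2.
have d0 i w : 0 <= d i w by exact: sqr_ge0.
pose W w : \bar R := (\sum_(0 <= i <oo) (2 ^+ i * d i w)%:E)%E.
have W0 i w : (0 <= (2 ^+ i * d i w)%:E)%E by rewrite lee_fin mulr_ge0// exprn_ge0.
have mWi i : measurable_fun setT (fun w => (2 ^+ i * d i w)%:E).
  apply/measurable_EFinP; apply: measurable_funM; first exact: measurable_cst.
  by apply: measurable_funX; apply: measurable_cabs; exact: cmeasurableB.
have mW : measurable_fun setT W.
  by apply: (@ge0_emeasurable_sum _ _ _ _ _ xpredT) => // k w _ _; exact: W0.
have iW : (\int[mu]_w W w < +oo)%E.
  rewrite integral_nneseries//.
  apply: (@le_lt_trans _ _ (\sum_(0 <= i <oo) (2 * (2^-1) ^+ i)%:E)%E); last first.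
    rewrite nneseries_esumT; last by move=> i; rewrite lee_fin mulr_ge0// exprn_ge0.
    apply: le_lt_trans (rsummableZ 2 rsummable_half_pow).
    by apply: le_esum => i _; rewrite lee_fin ler_norm.
  apply: lee_nneseries => [i _ _|i _]; first exact: integral_ge0.
  under eq_integral do rewrite EFinM.
  rewrite ge0_integralZl//; last 2 first.
  - by apply: measurable_cabs_sqr; exact: cmeasurableB.
  - by move=> w _; rewrite lee_fin.
  have h := sqint_trigB (A_ i.+1) (A_ i) sf.
  apply: (@le_trans _ _ ((2 ^+ i)%:E * (2 * (4^-1) ^+ i)%:E)%E).
    apply: lee_wpmul2l; first by rewrite lee_fin exprn_ge0.
    apply: le_trans h _; rewrite lee_fin mulr_natl mulr2n lerD//.
    apply: le_trans (A_e i.+1) _; rewrite exprS ler_piMl// ?exprn_ge0//.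
    by rewrite invf_le1// ler1n.
  rewrite -EFinM lee_fin mulrCA -exprMn (_ : 2 * 4^-1 = 2^-1 :> R)//.
  by field.
(* Partial sums along the sequence converge on [N], which has full measure. *)
pose N := [set w | (W w < +oo)%E].
have mN : measurable N.
  by rewrite -[N]setTI; exact: emeasurable_fun_infty_o.
have aeN : {ae mu, forall w, N w}.
  have : mu.-integrable setT W.
    apply/integrableP; split => //.
    under eq_integral do rewrite gee0_abs ?nneseries_ge0//.
    by [].
  move=> /(integrable_ae measurableT); apply: filterS => w /(_ I).
  by rewrite ge0_fin_numE// nneseries_ge0.
have sumN w : N w -> rsummable (fun i => 2 ^+ i * d i w + (2^-1) ^+ i).
  move=> Nw; apply: rsummableD; last exact: rsummable_half_pow.
  rewrite /rsummable; apply: le_lt_trans Nw.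
  rewrite /W nneseries_esumT//; apply: le_esum => i _.
  by rewrite lee_fin ger0_norm// mulr_ge0// exprn_ge0.
(* Completing the square. *)
have step i w : cabs (S i.+1 w - S i w) <= 2 ^+ i * d i w + (2^-1) ^+ i.
  rewrite /d; set x := cabs _.
  have p0 : 0 < (2 : R) ^+ i by rewrite exprn_gt0.
  rewrite exprVn -subr_ge0.
  have -> : 2 ^+ i * x ^+ 2 + (2 ^+ i)^-1 - x =
    2 ^+ i * (x - (2 ^+ i)^-1 / 2) ^+ 2 + 3 / 4 * (2 ^+ i)^-1.
    by field; rewrite gt_eqF.
  apply: addr_ge0; first by rewrite mulr_ge0 ?sqr_ge0// ltW.
  by rewrite mulr_ge0 ?divr_ge0// invr_ge0 ltW.
have cvR w : N w -> cvgn (fun i => complex.Re (S i w)).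
  move=> Nw; apply: cvg_summable_steps (sumN w Nw) => i.
  by rewrite -ReN -ReD (le_trans (ler_Re_cabs _)).
have cvI w : N w -> cvgn (fun i => complex.Im (S i w)).
  move=> Nw; apply: cvg_summable_steps (sumN w Nw) => i.
  by rewrite -ImN -ImD (le_trans (ler_Im_cabs _)).
pose FR w : R := \1_N w * limn (fun i => complex.Re (S i w)).
pose FI w : R := \1_N w * limn (fun i => complex.Im (S i w)).
pose F w := FR w +i* FI w.
have m1N : measurable_fun setT (\1_N : torus R n -> R) by exact: measurable_indic.
have mF : cmeasurable F.
  split => /=.
    apply: (@measurable_fun_cvg _ _ _ _ (fun i w => \1_N w * complex.Re (S i w))).
      by move=> i; apply: measurable_funM => //; have [] := mS i.
    move=> w _; rewrite /FR indicE; case: (boolP (w \in N)) => [|_].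
      by rewrite inE => /cvR h; apply: cvgM => //; exact: cvg_cst.
    rewrite mul0r; under eq_fun do rewrite mul0r; exact: cvg_cst.
  apply: (@measurable_fun_cvg _ _ _ _ (fun i w => \1_N w * complex.Im (S i w))).
    by move=> i; apply: measurable_funM => //; have [] := mS i.
  move=> w _; rewrite /FI indicE; case: (boolP (w \in N)) => [|_].
    by rewrite inE => /cvI h; apply: cvgM => //; exact: cvg_cst.
  rewrite mul0r; under eq_fun do rewrite mul0r; exact: cvg_cst.
have bound B : (sqint (fun w => (F w - trig B f w)%R) <= (l2tail f B)%:E)%E.
  have mFB : cmeasurable (fun w => F w - trig B f w).
    by apply: cmeasurableB => //; exact: cmeasurable_trig.
  have -> : sqint (fun w => F w - trig B f w) =
      (\int[mu]_w (\1_N w * cabs (F w - trig B f w) ^+ 2)%:E)%E.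
    apply: ge0_ae_eq_integral => //.
    - exact: measurable_cabs_sqr.
    - apply/measurable_EFinP; apply: measurable_funM => //.
      by apply: measurable_funX; exact: measurable_cabs.
    - by move=> w _; rewrite lee_fin sqr_ge0.
    - by move=> w _; rewrite lee_fin mulr_ge0 ?sqr_ge0.
    - apply: filterS aeN => w Nw _; rewrite indicE mem_set// mul1r.
      by [].
  (* Fatou's lemma along the sequence shifted past the rank where its tail is
     below [e]. *)
  apply/lee_addgt0Pr => e e0.
  have : \forall i \near \oo, (4^-1 : R) ^+ i <= e.
    have /cvgrPdist_le/(_ _ e0) : (fun i => (4^-1 : R) ^+ i) @ \oo --> (0 : R).
      by apply: cvg_expr; rewrite ger0_norm// invf_lt1// ltr1n.
    apply: filterS => i; rewrite sub0r normrN; apply: le_trans; exact: ler_norm.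
  move=> [m _ me].
  pose g i w := (\1_N w * cabs (S (i + m)%N w - trig B f w) ^+ 2)%:E.
  have mg i : measurable_fun setT (g i).
    apply/measurable_EFinP; apply: measurable_funM => //; apply: measurable_funX.
    by apply: measurable_cabs; apply: cmeasurableB => //; exact: cmeasurable_trig.
  have g0 i w : (0 <= g i w)%E by rewrite lee_fin mulr_ge0 ?sqr_ge0.
  have gcv w : (fun i => g i w) @ \oo --> (\1_N w * cabs (F w - trig B f w) ^+ 2)%:E.
    apply: cvg_EFin; first exact: nearW.
    rewrite /comp/=.
    rewrite indicE; case: (boolP (w \in N)) => [|_]; last first.
      by rewrite mul0r; under eq_fun do rewrite mul0r; exact: cvg_cst.
    rewrite inE => Nw; rewrite mul1r cabs_sqrB.
    under eq_fun do rewrite mul1r cabs_sqrB.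
    have c1 := cvR w Nw; have c2 := cvI w Nw.
    rewrite /F/= /FR /FI indicE mem_set// !mul1r.
    have sq (s : nat -> R) (l t : R) : s @ \oo --> l ->
        (fun i => (s (i + m)%N - t) ^+ 2) @ \oo --> (l - t) ^+ 2.
      move=> sl; rewrite expr2; under eq_fun do rewrite expr2.
      have c : (fun i => s (i + m)%N - t) @ \oo --> l - t.
        by apply: cvgB; [rewrite (cvg_shiftn m s)|exact: cvg_cst].
      exact: cvgM.
    by apply: cvgD; [exact: (sq (fun i => complex.Re (S i w)) _ _ c1)|
      exact: (sq (fun i => complex.Im (S i w)) _ _ c2)].
  have -> : (\int[mu]_w (\1_N w * cabs (F w - trig B f w) ^+ 2)%:E =
      \int[mu]_w limn_einf (fun i => g i w))%E.
    by apply: eq_integral => w _; rewrite (cvg_limn_einf_sup (gcv w)).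
  apply: le_trans (fatou _ _ _ _) _ => //.
  apply: limn_einf_le => i.
  apply: (@le_trans _ _ (l2tail f (A_ (i + m)%N) + l2tail f B)%:E).
    apply: le_trans (sqint_trigB _ _ sf).
    apply: ge0_le_integral => //.
    - by apply: measurable_cabs_sqr; apply: cmeasurableB; exact: cmeasurable_trig.
    - move=> w _; rewrite lee_fin ler_piMl ?sqr_ge0//.
  rewrite -EFinD lee_fin addrC lerD2l (le_trans (A_e _))//.
  by apply: me => /=; rewrite leq_addl.
exists F; apply/is_fourier_l2P; split => //.
- have mT := cmeasurable_trig (A_ 0%N) f.
  rewrite (_ : F = (fun w => (F w - trig (A_ 0%N) f w) + trig (A_ 0%N) f w)); last first.
    by apply/funext => w; rewrite subrK.
  apply: le_lt_trans (sqintD (cmeasurableB mF mT) mT) _.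
  rewrite sqint_trig; apply: lte_add_pinfty; last by rewrite -EFinM ltry.
  apply: (@le_lt_trans _ _ (2%:E * (l2tail f (A_ 0%N))%:E)%E).
    by apply: lee_wpmul2l.
  by rewrite -EFinM ltry.
- move=> e e0; apply: filterS (l2tail_small sf e0) => B Be.
  by apply: le_trans (bound B) _; rewrite lee_fin.
Qed.

End SquareSummable.

(** * Uniqueness and injectivity of the Fourier transform on l2 *)

Section Uniqueness.
Context {R : realType} {n : nat}.
Local Notation mu := (haar R n).
Local Notation tot := (@summability.totally (Zn n)).
Implicit Types (F G : torus R n -> R[i]) (f g : Zn n -> R[i]).

(** Two L2 limits of the same partial sums are at distance zero. *)
Lemma fourier_l2_ae_unique f F G : is_fourier_l2 f F -> is_fourier_l2 f G ->
  {ae mu, forall w, F w = G w}.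
Proof.
move=> /is_fourier_l2P[mF _ cF] /is_fourier_l2P[mG _ cG].
have : sqint (fun w => F w - G w) = 0%E.
  apply/eqP; rewrite eq_le sqint_ge0 andbT; apply/lee_addgt0Pr => e e0.
  have e4 : 0 < e / 4 by rewrite divr_gt0.
  have [A [hF hG]] : exists A, (sqint (fun w => (F w - trig A f w)%R) <= (e / 4)%:E)%E /\
      (sqint (fun w => (G w - trig A f w)%R) <= (e / 4)%:E)%E.
    exact: (filter_ex (filterI (cF _ e4) (cG _ e4))).
  have mT := cmeasurable_trig A f.
  rewrite (_ : (fun w => _) = (fun w => (F w - trig A f w) + (trig A f w - G w))); last first.
    by apply/funext => w; rewrite addrA subrK.
  apply: le_trans (sqintD (cmeasurableB mF mT) (cmeasurableB mT mG)) _.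
  rewrite [X in (_ + 2%:E * X)%E]sqintC.
  apply: le_trans (leeD (lee_wpmul2l _ hF) (lee_wpmul2l _ hG)) _ => //.
  rewrite -!EFinM -EFinD add0e lee_fin.
  by rewrite (_ : 2 * (e / 4) + 2 * (e / 4) = e)//; field.
move=> /(sqint_eq0_ae (cmeasurableB mF mG)); apply: filterS => w /eqP.
by rewrite subr_eq0 => /eqP.
Qed.

(** By Parseval's identity, partial sums with close L2 limits have close
    coefficients. *)
Lemma fourier_l2_inj f g F G : is_fourier_l2 f F -> is_fourier_l2 g G ->
  {ae mu, forall w, F w = G w} -> f = g.
Proof.
move=> /is_fourier_l2P[mF _ cF] /is_fourier_l2P[mG _ cG] FG.
apply/funext => k; apply/eqP; rewrite -subr_eq0; apply/eqP.
apply: ComplexField.Normc.eq0_normc; apply/eqP; rewrite -sqrf_eq0.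
rewrite eq_le sqr_ge0 andbT; apply/ler_addgt0Pr => e e0; rewrite add0r.
have e4 : 0 < e / 4 by rewrite divr_gt0.
have nk : \forall A \near tot, k \in A.
  by exists [fset k]%fset => // A /= /fsubsetP; apply; rewrite inE.
have [A [[hF hG] kA]] : exists A,
    ((sqint (fun w => (F w - trig A f w)%R) <= (e / 4)%:E)%E /\
      (sqint (fun w => (G w - trig A g w)%R) <= (e / 4)%:E)%E) /\ k \in A.
  exact: (filter_ex (filterI (filterI (cF _ e4) (cG _ e4)) nk)).
have mf := cmeasurable_trig A f; have mg := cmeasurable_trig A g.
have : (sqint (trig A (fun k => (f k - g k)%R)) <= e%:E)%E.
  rewrite (_ : trig _ _ = (fun w => (trig A f w - F w) + (F w - trig A g w))); last first.
    by apply/funext => w; rewrite trigB addrA subrK.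
  apply: le_trans (sqintD (cmeasurableB mf mF) (cmeasurableB mF mg)) _.
  rewrite [X in (2%:E * X + _)%E]sqintC.
  rewrite (@eq_ae_sqint _ _ (fun w => F w - trig A g w) (fun w => G w - trig A g w));
    [|exact: cmeasurableB|exact: cmeasurableB|by apply: filterS FG => w ->].
  apply: le_trans (leeD (lee_wpmul2l _ hF) (lee_wpmul2l _ hG)) _ => //.
  rewrite -!EFinM -EFinD lee_fin.
  by rewrite (_ : 2 * (e / 4) + 2 * (e / 4) = e)//; field.
rewrite sqint_trig lee_fin; apply: le_trans.
rewrite (big_fsetD1 k)//= lerDl sumr_ge0// => l _; exact: sqr_ge0.
Qed.

Lemma fourier_l2_is_fourier f : in_l2 f -> is_fourier_l2 f (fourier_l2 f).
Proof. by move=> /in_l2P /Riesz_Fischer; exact: xgetPex. Qed.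

End Uniqueness.

(** * Convolution *)

Section Convolution.
Context {R : realType} {n : nat}.
Local Notation tot := (@summability.totally (Zn n)).
Local Notation "z ^*" := (conjc z) : ring_scope.
Implicit Types (f g K : Zn n -> R[i]) (x y z : Zn n -> R).

(** In the variables [k], [k - m], [l - m] the three factors are independent. *)
Lemma rsum_conv_left x y z : rsummable x -> rsummable y -> rsummable z ->
  let T := fun t : Zn n * (Zn n * Zn n) =>
    x t.2.1 * (y (t.2.1 - t.1) * z (t.2.2 - t.1)) in
  rsummable T /\ rsum T = rsum x * (rsum y * rsum z).
Proof.
move=> sx sy sz T.
pose e (t : Zn n * (Zn n * Zn n)) := (t.2.1, (t.2.1 - t.1, t.2.2 - t.1)).
pose e' (s : Zn n * (Zn n * Zn n)) := (s.1 - s.2.1, (s.1, s.2.2 + (s.1 - s.2.1))).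
have ee' : cancel e e'.
  by case=> m [k l]; rewrite /e /e' /= subKr subrK.
have e'e : cancel e' e.
  by case=> k [i j]; rewrite /e /e' /= subKr addrK.
have syz := rsummableM sy sz.
have s3 := rsummableM sx syz.
split; first exact: (rsummable_comp ee' e'e s3).
by rewrite -rsumM// -rsumM// (reindex_rsum ee' e'e s3).
Qed.

(** In the variables [l], [k - m], [l - m] the three factors are independent. *)
Lemma rsum_conv_right x y z : rsummable x -> rsummable y -> rsummable z ->
  let T := fun t : Zn n * (Zn n * Zn n) =>
    x t.2.2 * (y (t.2.1 - t.1) * z (t.2.2 - t.1)) in
  rsummable T /\ rsum T = rsum x * (rsum y * rsum z).
Proof.
move=> sx sy sz T.
pose e (t : Zn n * (Zn n * Zn n)) := (t.2.2, (t.2.1 - t.1, t.2.2 - t.1)).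
pose e' (s : Zn n * (Zn n * Zn n)) := (s.1 - s.2.2, (s.2.1 + (s.1 - s.2.2), s.1)).
have ee' : cancel e e'.
  by case=> m [k l]; rewrite /e /e' /= subKr subrK.
have e'e : cancel e' e.
  by case=> l [i j]; rewrite /e /e' /= subKr addrK.
have syz := rsummableM sy sz.
have s3 := rsummableM sx syz.
split; first exact: (rsummable_comp ee' e'e s3).
by rewrite -rsumM// -rsumM// (reindex_rsum ee' e'e s3).
Qed.

(** The inequality of arithmetic and geometric means separates the two
    square-summable factors, after which each half is a product of three
    independent sums. *)
Lemma quadrilinear_bound (a b p q : Zn n -> R[i]) :
  sqsummable a -> sqsummable b -> csummable p -> csummable q ->
  let T := fun t : Zn n * (Zn n * Zn n) =>
    cabs (a t.2.1) * cabs (b t.2.2) * (cabs (p (t.2.1 - t.1)) * cabs (q (t.2.2 - t.1))) in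
  rsummable T /\
  rsum T <= 2^-1 * (rsum (fun k => cabs (a k) ^+ 2) + rsum (fun k => cabs (b k) ^+ 2)) *
    (rsum (fun k => cabs (p k)) * rsum (fun k => cabs (q k))).
Proof.
move=> sa sb sp sq T.
have [s1 e1] := rsum_conv_left sa sp sq.
have [s2 e2] := rsum_conv_right sb sp sq.
have s := rsummableZ 2^-1 (rsummableD s1 s2).
have Tle t : `|T t| <= 2^-1 * (
    cabs (a t.2.1) ^+ 2 * (cabs (p (t.2.1 - t.1)) * cabs (q (t.2.2 - t.1))) +
    cabs (b t.2.2) ^+ 2 * (cabs (p (t.2.1 - t.1)) * cabs (q (t.2.2 - t.1)))).
  rewrite ger0_norm; last by rewrite !mulr_ge0 ?cabs_ge0.
  rewrite /T; set u := cabs (p _) * _; have u0 : 0 <= u by rewrite mulr_ge0 ?cabs_ge0.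
  rewrite -subr_ge0 (_ : _ - _ = 2^-1 * (cabs (a t.2.1) - cabs (b t.2.2)) ^+ 2 * u).
    by apply: mulr_ge0 => //; apply: mulr_ge0 => //; exact: sqr_ge0.
  by field.
split; first exact: rsummable_le Tle s.
apply: le_trans (ler_norm _) _; apply: le_trans (ler_norm_rsum Tle s) _.
by rewrite rsumZ ?rsumD// ?e1 ?e2 -?mulrDl ?mulrA//; exact: rsummableD.
Qed.

Lemma csummable_sqsummable f : csummable f -> sqsummable f.
Proof.
move=> sf; apply: rsummable_le (rsummableZ (rsum (fun k => cabs (f k))) sf) => k.
rewrite ger0_norm ?sqr_ge0// expr2 ler_wpM2r ?cabs_ge0//.
have := @sum_fset_le_rsum _ _ _ [fset k]%fset (fun k => cabs_ge0 (f k)) sf.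
by rewrite big_seq_fset1.
Qed.

Lemma sqsummableM f g : sqsummable f -> sqsummable g -> csummable (fun k => f k * g k).
Proof.
move=> sf sg; apply: csummable_le (rsummableZ 2^-1 (rsummableD sf sg)) => k.
rewrite cabsM -subr_ge0.
rewrite (_ : _ - _ = 2^-1 * (cabs (f k) - cabs (g k)) ^+ 2); last by field.
by rewrite mulr_ge0 ?sqr_ge0.
Qed.

Lemma csummable_shift f m : csummable f -> csummable (fun k => f (k - m)).
Proof.
have c1 : cancel (fun k : Zn n => k - m) (fun k => k + m) by move=> k; rewrite subrK.
have c2 : cancel (fun k : Zn n => k + m) (fun k => k - m) by move=> k; rewrite addrK.
exact: (rsummable_comp c1 c2).
Qed.

Lemma csummable_reflect f m : csummable f -> csummable (fun k => f (m - k)).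
Proof.
have c1 : cancel (fun k : Zn n => m - k) (fun k => m - k) by move=> k; rewrite subKr.
exact: (rsummable_comp c1 c1).
Qed.

Definition conv K f : Zn n -> R[i] := fun l => gsum (fun k => f k * K (l - k)).

Lemma csummable_conv_term K f l : csummable K -> sqsummable f ->
  csummable (fun k => f k * K (l - k)).
Proof.
by move=> sK sf; apply: sqsummableM => //; apply/csummable_sqsummable/csummable_reflect.
Qed.

Lemma convB K f g l : csummable K -> sqsummable f -> sqsummable g ->
  conv K (fun k => f k - g k) l = conv K f l - conv K g l.
Proof.
move=> sK sf sg; rewrite /conv -gsumB; [|exact: csummable_conv_term..].
by apply: eq_gsum => k; rewrite mulrBl.
Qed.

(** Young's inequality. The square of each term is a double sum, so that the sum
    of squares is bounded by the triple sum of [quadrilinear_bound] with both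
    sequences equal to [f] and both kernels equal to the reflection of [K]. *)
Lemma young K f : csummable K -> sqsummable f ->
  sqsummable (conv K f) /\
  rsum (fun l => cabs (conv K f l) ^+ 2) <=
    rsum (fun k => cabs (K k)) ^+ 2 * rsum (fun k => cabs (f k) ^+ 2).
Proof.
move=> sK sf.
pose p k := K (0 - k).
have sp : csummable p by exact: csummable_reflect.
have [sT leT] := quadrilinear_bound sf sf sp sp.
have rp : rsum (fun k => cabs (p k)) = rsum (fun k => cabs (K k)).
  have c1 : cancel (fun k : Zn n => 0 - k) (fun k => 0 - k) by move=> k; rewrite subKr.
  by rewrite (reindex_rsum c1 c1 sK).
have s1 := rsummable_rsum sT.
have le1 l : `|cabs (conv K f l) ^+ 2| <= rsum (fun kk : Zn n * Zn n =>
    cabs (f kk.1) * cabs (f kk.2) * (cabs (p (kk.1 - l)) * cabs (p (kk.2 - l)))).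
  rewrite ger0_norm ?sqr_ge0// expr2 -cabsM.
  have sc := csummable_conv_term l sK sf.
  rewrite /conv gsumM//; apply: ler_cabs_gsum; last exact: (rsummable_section l sT).
  move=> -[k k'] /=; rewrite /p !sub0r !opprB !cabsM.
  by rewrite mulrACA.
split; first exact: rsummable_le le1 s1.
apply: le_trans (ler_norm _) _; apply: le_trans (ler_norm_rsum le1 s1) _.
rewrite -(rsum_pair sT); apply: le_trans leT _; rewrite rp -expr2 mulrC ler_wpM2l//.
  exact: sqr_ge0.
by rewrite (_ : 2^-1 * _ = rsum (fun k => cabs (f k) ^+ 2))//; field.
Qed.

Lemma csummable_char f xi : csummable f ->
  csummable (fun k => cexp2pi (- dot k xi) * f k).
Proof.
by apply: csummable_le => k; rewrite cabsM cabs_cexp2pi mul1r.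
Qed.

Lemma conv_bijection (I : zmodType) :
  cancel (fun p : I * I => (p.1 - p.2, p.2)) (fun p => (p.1 + p.2, p.2)) /\
  cancel (fun p : I * I => (p.1 + p.2, p.2)) (fun p => (p.1 - p.2, p.2)).
Proof. by split; case=> l k /=; rewrite ?subrK ?addrK. Qed.

Lemma csummable_conv K f : csummable K -> csummable f -> csummable (conv K f).
Proof.
move=> sK sf; have [c1 c2] := conv_bijection (Zn n).
have -> : conv K f = (fun l => gsum (fun k => K (l - k) * f k)).
  by apply/funext => l; apply: eq_gsum => k; rewrite mulrC.
exact: (csummable_gsum (csummable_comp c1 c2 (csummableM sK sf))).
Qed.

Lemma fourier_conv K f xi : csummable K -> csummable f ->
  fourier (conv K f) xi = fourier K xi * fourier f xi.
Proof.
move=> sK sf; have [c1 c2] := conv_bijection (Zn n).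
have sK' := csummable_char xi sK; have sf' := csummable_char xi sf.
have sKf := csummableM sK' sf'.
rewrite [RHS](gsumM sK' sf') (reindex_gsum c1 c2 sKf).
rewrite gsum_pair; last exact: (csummable_comp c1 c2 sKf).
apply: eq_gsum => l; rewrite /conv -gsumZ; last first.
  exact/csummable_conv_term/csummable_sqsummable.
apply: eq_gsum => k /=.
have -> : - dot l xi = - dot (l - k) xi + - dot k xi by rewrite dotB opprB addrAC subrr sub0r.
by rewrite cexp2piD; ring.
Qed.

End Convolution.

(** * The convolution theorem on l2 *)

Section ConvolutionTheorem.
Context {R : realType} {n : nat}.
Local Notation tot := (@summability.totally (Zn n)).
Implicit Types (f K : Zn n -> R[i]) (F : torus R n -> R[i]).

Lemma cmeasurable_fourier K : csummable K -> cmeasurable (fourier K).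
Proof.
move=> sK; apply: cmeasurable_gsum => [k|w]; last exact: csummable_char.
by apply: cmeasurableM; [exact: cmeasurable_charN|exact: cmeasurable_cst].
Qed.

Lemma cabs_char_mul (k : Zn n) xi (z : R[i]) : cabs (cexp2pi (- dot k xi) * z) = cabs z :> R.
Proof. by rewrite cabsM cabs_cexp2pi mul1r. Qed.

Lemma cabs_fourier_le K xi : csummable K ->
  cabs (fourier K xi) <= rsum (fun k => cabs (K k)).
Proof. by move=> sK; apply: ler_cabs_gsum => // k; rewrite cabs_char_mul. Qed.

Lemma sqint_fourier_tail K (A : {fset Zn n}) : csummable K ->
  (sqint (fun xi => (fourier K xi - trig A K xi)%R) <=
   ((rsum (fun k => cabs (K k)) - \sum_(k <- A) cabs (K k)) ^+ 2)%:E)%E.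
Proof.
move=> sK; apply: sqint_le_bound.
- by apply: cmeasurableB; [exact: cmeasurable_fourier|exact: cmeasurable_trig].
- by rewrite subr_ge0 sum_fset_le_rsum// => k; exact: cabs_ge0.
- by move=> xi; apply: gsum_tail => // k; rewrite cabs_char_mul.
Qed.

(** [f] is split into a finitely supported part, for which the series of
    [conv K f] converges uniformly, and a part that is small in l2, which both
    convolution with [K] and multiplication by the bounded function [fourier K]
    keep small. *)
Lemma is_fourier_l2_conv K f F : csummable K -> sqsummable f ->
  is_fourier_l2 f F -> is_fourier_l2 (conv K f) (fun xi => fourier K xi * F xi).
Proof.
move=> sK sf /is_fourier_l2P[mF Fy cF].
have mK := cmeasurable_fourier sK.
pose kappa := rsum (fun k => cabs (K k)).
have kappa0 : 0 <= kappa by apply: rsum_ge0 => // k; exact: cabs_ge0.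
have mKF : cmeasurable (fun xi => fourier K xi * F xi) by exact: cmeasurableM.
have sqK G : cmeasurable G ->
    (sqint (fun xi => (fourier K xi * G xi)%R) <= (kappa ^+ 2)%:E * sqint G)%E.
  move=> mG; apply: sqintM_le => //; first exact: cmeasurableM.
  by move=> xi; rewrite cabsM ler_wpM2r ?cabs_ge0// cabs_fourier_le.
apply/is_fourier_l2P; split=> //.
  apply: le_lt_trans (sqK _ mF) _; have F0 := sqint_ge0 F.
  by rewrite -(@fineK _ (sqint F)) ?ge0_fin_numE// -EFinM ltry.
move=> e e0.
(* The three errors enter with weights 2, 4 and 4: the first and the third are at
   most [kappa ^+ 2 * dl <= e / 12], the second at most [e / 8]. *)
pose dl := e / (12 * (kappa ^+ 2 + 1)).
have k1 : 0 < kappa ^+ 2 + 1 by rewrite ltr_wpDl ?sqr_ge0.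
have dl0 : 0 < dl by rewrite divr_gt0// mulr_gt0.
have [D [hD tD]] : exists D, (sqint (fun w => (F w - trig D f w)%R) <= dl%:E)%E /\
    l2tail f D <= dl.
  exact: (filter_ex (filterI (cF _ dl0) (l2tail_small sf dl0))).
pose fD k := if k \in D then f k else 0.
pose fC k := f k - fD k.
have sfD : csummable fD.
  apply: (@rsummable_fset_support _ _ _ D) => k /negbTE kD.
  by rewrite /fD kD ComplexField.Normc.normc0.
have sfD2 := csummable_sqsummable sfD.
have fCE k : cabs (fC k) ^+ 2 = cabs (f k) ^+ 2 - cabs (fD k) ^+ 2.
  by rewrite /fC /fD; case: ifP => _; rewrite ?subrr ?subr0 ?ComplexField.Normc.normc0
    ?expr0n ?subr0 ?subrr.
have sfC : sqsummable fC.
  have := rsummableB sf sfD2; congr rsummable; apply/funext => k; exact/esym.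
have fC_small : rsum (fun k => cabs (fC k) ^+ 2) <= dl.
  rewrite (eq_rsum fCE) rsumB// (@rsum_fset_support _ _ (fun k => cabs (fD k) ^+ 2) D).
    apply: le_trans tD; rewrite /l2tail lerD2l lerN2 le_eqVlt; apply/orP; left.
    by apply/eqP; apply: eq_big_seq => k kD; rewrite /fD kD.
  by move=> k /negbTE kD; rewrite /fD kD ComplexField.Normc.normc0 expr0n.
have trD xi : trig D f xi = fourier fD xi.
  rewrite /fourier csumE (@gsum_fset_support _ _ _ D).
    by apply: eq_big_seq => k kD; rewrite /fD kD.
  by move=> k /negbTE kD; rewrite /fD kD mulr0.
pose uD := conv K fD.
have suD : csummable uD by exact: csummable_conv.
have fuD xi : fourier uD xi = fourier K xi * trig D f xi by rewrite fourier_conv// trD.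
have [syoung young_le] := young sK sfC.
have convE l : conv K f l = uD l + conv K fC l.
  by rewrite convB// addrC subrK.
have e8 : 0 < Num.sqrt (e / 8) by rewrite sqrtr_gt0 divr_gt0.
pose tau (A : {fset Zn n}) :=
  rsum (fun k => cabs (uD k)) - \sum_(k <- A) cabs (uD k).
have : \forall A \near tot, tau A <= Num.sqrt (e / 8).
  have /cvgrPdist_le/(_ _ e8) := cvg_rsum suD.
  apply: filterS => A; rewrite partial_sumE; apply: le_trans; exact: ler_norm.
apply: filterS => A hA.
have mT := cmeasurable_trig.
have mFD : cmeasurable (fun xi => F xi - trig D f xi) by exact: cmeasurableB.
have m1 : cmeasurable (fun xi => fourier K xi * (F xi - trig D f xi)) by exact: cmeasurableM.
have m2 : cmeasurable (fun xi => fourier uD xi - trig A uD xi).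
  by apply: cmeasurableB => //; exact: cmeasurable_fourier.
have m3 : cmeasurable (fun xi => - trig A (conv K fC) xi) by exact: cmeasurableN.
have b1 : (sqint (fun xi => (fourier K xi * (F xi - trig D f xi))%R) <=
    (kappa ^+ 2 * dl)%:E)%E.
  apply: le_trans (sqK _ mFD) _; rewrite [leRHS]EFinM.
  have k2 : (0 <= (kappa ^+ 2)%:E)%E by rewrite lee_fin sqr_ge0.
  exact: (lee_wpmul2l k2 hD).
have b2 : (sqint (fun xi => (fourier uD xi - trig A uD xi)%R) <= (e / 8)%:E)%E.
  apply: le_trans (sqint_fourier_tail A suD) _; rewrite lee_fin.
  have e80 : 0 <= e / 8 by rewrite ltW// divr_gt0.
  rewrite -[leRHS](sqr_sqrtr e80) ler_pXn2r ?nnegrE ?sqrtr_ge0//.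
  by rewrite subr_ge0 sum_fset_le_rsum// => k; exact: cabs_ge0.
have b3 : (sqint (fun xi => (- trig A (conv K fC) xi)%R) <= (kappa ^+ 2 * dl)%:E)%E.
  rewrite (_ : sqint _ = sqint (trig A (conv K fC))); last first.
    by apply: eq_integral => xi _; rewrite cabsN.
  rewrite sqint_trig lee_fin; apply: le_trans (sum_fset_le_rsum _ _ syoung) _.
    by move=> k; exact: sqr_ge0.
  by apply: le_trans young_le _; rewrite ler_wpM2l// sqr_ge0.
rewrite (_ : (fun w => _) = (fun xi => fourier K xi * (F xi - trig D f xi) +
    ((fourier uD xi - trig A uD xi) + - trig A (conv K fC) xi))); last first.
  apply/funext => xi; rewrite fuD (_ : conv K f = (fun l => uD l + conv K fC l)); last first.
    by apply/funext.
  by rewrite trigD; ring.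
apply: le_trans (sqintD m1 (cmeasurableD m2 m3)) _.
have two0 : (0 <= 2%:E :> \bar R)%E by rewrite lee_fin.
have b23 := le_trans (sqintD m2 m3) (leeD (lee_wpmul2l two0 b2) (lee_wpmul2l two0 b3)).
apply: le_trans (leeD (lee_wpmul2l two0 b1) (lee_wpmul2l two0 b23)) _.
rewrite -!EFinM -!EFinD lee_fin.
have h : kappa ^+ 2 * dl <= e / 12.
  rewrite -subr_ge0 (_ : e / 12 - kappa ^+ 2 * dl = dl); first exact: ltW.
  by rewrite /dl; field; rewrite gt_eqF.
by lra.
Qed.

End ConvolutionTheorem.

(** * The kernel of the localization operator *)

Section Kernel.
Context {R : realType} {n : nat}.
Local Notation mu := (haar R n).
Local Notation "z ^*" := (conjc z) : ring_scope.
Implicit Types (f h g : Zn n -> R[i]) (b : torus R n -> R[i]).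

Lemma num_conjE (z : R[i]) : Num.conj z = z^*.
Proof. by []. Qed.

Definition char_coef b (j : Zn n) : R[i] := cint (fun w => b w * cexp2pi (dot j w)).

Definition cross_corr g1 g2 (j : Zn n) : R[i] := gsum (fun p => (g1 p)^* * g2 (p + j)).

Definition loc_kernel b g1 g2 (j : Zn n) : R[i] := char_coef b j * cross_corr g1 g2 j.

Context (g1 g2 : Zn n -> R[i]) (b : torus R n -> R[i]).
Context (s1 : csummable g1) (s2 : csummable g2) (ib : cintegrable b).

Lemma cabs_char_coef_le j : cabs (char_coef b j) <= \int[mu]_w cabs (b w).
Proof.
apply: ler_cabs_cint_mul => //; first exact: cmeasurable_char.
by move=> w; rewrite cabs_cexp2pi.
Qed.

Lemma corr_bijection :
  cancel (fun p : Zn n * Zn n => (p.2, p.2 + p.1)) (fun q => (q.2 - q.1, q.1)) /\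
  cancel (fun q : Zn n * Zn n => (q.2 - q.1, q.1)) (fun p => (p.2, p.2 + p.1)).
Proof.
by split; case=> j p /=; rewrite ?[p + j]addrC ?addrK// addrC subrK.
Qed.

Lemma csummable_corr_pairs : csummable (fun p : Zn n * Zn n => (g1 p.2)^* * g2 (p.2 + p.1)).
Proof.
have [c1 c2] := corr_bijection.
exact: (csummable_comp c1 c2 (csummableM (csummableJ s1) s2)).
Qed.

(** The character coefficients are bounded by the L1 norm of [b], and the
    cross-correlation of summable windows is summable. *)
Lemma csummable_loc_kernel : csummable (loc_kernel b g1 g2).
Proof.
apply: csummable_le (rsummableZ (\int[mu]_w cabs (b w)) (csummable_gsum csummable_corr_pairs)).
by move=> j; rewrite cabsM ler_wpM2r ?cabs_ge0// cabs_char_coef_le.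
Qed.

Lemma cint_char_scaled (c : R[i]) j (phi : torus R n -> R[i]) :
  (forall w, phi w = c * cexp2pi (dot j w)) ->
  cint (fun w => b w * phi w) = c * char_coef b j.
Proof.
move=> E; rewrite -cintZ.
  by congr cint; apply/funext => w; rewrite E; ring.
apply: (cintegrable_mul_bounded (C := 1)) => //; first exact: cmeasurable_char.
by move=> w; rewrite cabs_cexp2pi.
Qed.

(** The product of the two window series is a sum over pairs [(k, l)] with
    phases [cexp2pi (dot (l - k) w)]; integration in [w] gives [B (l - k)], and the
    change of variables [j = l - k] collects the cross-correlation. *)
Lemma symbol_fourier xi :
  cint (fun w => b w * Num.conj (fourier (modulation w g1) xi)
                 * fourier (modulation w g2) xi) = fourier (loc_kernel b g1 g2) xi.
Proof.
have smod g w : csummable g ->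
    csummable (fun k => cexp2pi (- dot k xi) * (cexp2pi (dot k w) * g k)).
  by apply: csummable_le => k; rewrite !cabsM !cabs_cexp2pi !mul1r.
pose phi (p : Zn n * Zn n) w := (cexp2pi (- dot p.1 xi) * (cexp2pi (dot p.1 w) * g1 p.1))^* *
  (cexp2pi (- dot p.2 xi) * (cexp2pi (dot p.2 w) * g2 p.2)).
have phiE p w : phi p w = ((g1 p.1)^* * g2 p.2 * cexp2pi (- dot (p.2 - p.1) xi)) *
    cexp2pi (dot (p.2 - p.1) w).
  rewrite /phi !conjM !cexp2piJ !dotB opprK opprB.
  rewrite [cexp2pi (dot p.1 xi - _)]cexp2piD [cexp2pi (dot p.2 w - _)]cexp2piD.
  by ring.
have cabs_phi p w : cabs (phi p w) <= cabs (g1 p.1) * cabs (g2 p.2).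
  by rewrite phiE !cabsM !cabs_cexp2pi !mulr1 cabsJ.
rewrite (_ : (fun w => _) = (fun w => b w * gsum (phi^~ w))); last first.
  apply/funext => w; rewrite -mulrA num_conjE; congr (_ * _).
  rewrite /fourier !csumE -gsumJ; last exact: smod.
  by rewrite gsumM//; [exact/csummableJ/smod|exact: smod].
rewrite (cint_gsum ib _ cabs_phi); last 2 first.
- move=> p; rewrite (_ : phi p = (fun w => ((g1 p.1)^* * g2 p.2 *
      cexp2pi (- dot (p.2 - p.1) xi)) * cexp2pi (dot (p.2 - p.1) w))).
    by apply: cmeasurableM; [exact: cmeasurable_cst|exact: cmeasurable_char].
  by apply/funext => w; exact: phiE.
- exact: (rsummableM s1 s2).
have [c1 c2] := corr_bijection.
rewrite (eq_gsum (fun p => cint_char_scaled (phiE p))).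
have sT : csummable (fun p : Zn n * Zn n =>
    (g1 p.1)^* * g2 p.2 * cexp2pi (- dot (p.2 - p.1) xi) * char_coef b (p.2 - p.1)).
  apply: csummable_le (rsummableZ (\int[mu]_w cabs (b w)) (csummableM (csummableJ s1) s2)) => p.
  rewrite cabsM mulrC ler_pM ?cabs_ge0 ?cabs_char_coef_le//.
  by rewrite cabsM cabs_cexp2pi mulr1.
rewrite (reindex_gsum c1 c2 sT) gsum_pair; last exact: (csummable_comp c1 c2 sT).
rewrite /fourier csumE; apply: eq_gsum => j; rewrite /loc_kernel /cross_corr mulrA -gsumZ.
  by apply: eq_gsum => p /=; rewrite [p + j]addrC addrK; ring.
exact: (csummable_section j csummable_corr_pairs).
Qed.

(** Both factors of the localization form are absolutely convergent series, and
    the integral over the torus turns their product into a sum over pairs of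
    lattice points; the sum over the remaining lattice variable builds the
    cross-correlation of the windows. *)
Lemma localization_form_conv f h : sqsummable f -> sqsummable h ->
  localization_form g1 g2 (fun _ w => b w) f h = inner (conv (loc_kernel b g1 g2) f) h.
Proof.
move=> sf sh.
pose T (t : Zn n * (Zn n * Zn n)) : R[i] :=
  f t.2.1 * (h t.2.2)^* * ((g1 (t.2.1 - t.1))^* * g2 (t.2.2 - t.1)) *
  char_coef b (t.2.2 - t.2.1).
have sT : csummable T.
  have [s _] := quadrilinear_bound sf sh s1 s2.
  apply: csummable_le (rsummableZ (\int[mu]_w cabs (b w)) s) => t.
  by rewrite /T cabsM mulrC ler_pM ?cabs_ge0 ?cabs_char_coef_le// !cabsM !cabsJ.
have sV g u m w : csummable g -> sqsummable u ->
    csummable (fun k => u k * (cexp2pi (dot k w) * g (k - m))^*).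
  move=> sg su; apply: sqsummableM => //.
  have : sqsummable (fun k => g (k - m)) by exact/csummable_sqsummable/csummable_shift.
  by apply: rsummable_le => k;
    rewrite cabsJ cabsM cabs_cexp2pi mul1r ger0_norm// sqr_ge0.
have sfg u g m : sqsummable u -> csummable g -> csummable (fun k => u k * g (k - m)).
  by move=> su sg; apply: sqsummableM => //; exact/csummable_sqsummable/csummable_shift.
have stftE g u m w : stft g u m w =
    gsum (fun k => u k * (cexp2pi (dot k w) * g (k - m))^*) by [].
rewrite /localization_form csumE.
transitivity (gsum (fun m => gsum (fun kl => T (m, kl)))).
  apply: eq_gsum => m.
  pose phi (p : Zn n * Zn n) w := (f p.1 * (cexp2pi (dot p.1 w) * g1 (p.1 - m))^*) *
    (h p.2 * (cexp2pi (dot p.2 w) * g2 (p.2 - m))^*)^*.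
  have phiE p w : phi p w = (f p.1 * (h p.2)^* * ((g1 (p.1 - m))^* * g2 (p.2 - m))) *
      cexp2pi (dot (p.2 - p.1) w).
    by rewrite /phi !conjM !conjcK cexp2piJ dotB cexp2piD; ring.
  rewrite (_ : (fun w => _) = (fun w => b w * gsum (phi^~ w))); last first.
    apply/funext => w; rewrite -mulrA num_conjE !stftE; congr (_ * _).
    rewrite -gsumJ; last exact: sV.
    by rewrite gsumM//; [exact: sV|exact/csummableJ/sV].
  have cabs_phi p w : cabs (phi p w) <=
      cabs (f p.1 * g1 (p.1 - m)) * cabs (h p.2 * g2 (p.2 - m)).
    rewrite phiE !cabsM cabs_cexp2pi !cabsJ mulr1.
    by rewrite mulrACA.
  rewrite (cint_gsum ib _ cabs_phi); last 2 first.
  - move=> p; rewrite (_ : phi p = (fun w => (f p.1 * (h p.2)^* *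
        ((g1 (p.1 - m))^* * g2 (p.2 - m))) * cexp2pi (dot (p.2 - p.1) w))).
      by apply: cmeasurableM; [exact: cmeasurable_cst|exact: cmeasurable_char].
    by apply/funext => w; exact: phiE.
  - exact: (rsummableM (sfg f g1 m sf s1) (sfg h g2 m sh s2)).
  by apply: eq_gsum => p; rewrite (cint_char_scaled (phiE p)).
rewrite -gsum_pair// gsum_pair_swap//.
have TE (kl : Zn n * Zn n) : gsum (fun m => T (m, kl)) =
    f kl.1 * loc_kernel b g1 g2 (kl.2 - kl.1) * (h kl.2)^*.
  have c1 : cancel (fun p : Zn n => kl.1 - p) (fun p => kl.1 - p).
    by move=> p; rewrite subKr.
  rewrite (reindex_gsum c1 c1); last exact: (csummable_section kl (csummable_swap sT)).
  rewrite (_ : (fun m => _) \o _ = (fun p => f kl.1 * (h kl.2)^* * char_coef b (kl.2 - kl.1) *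
      ((g1 p)^* * g2 (p + (kl.2 - kl.1))))).
    rewrite gsumZ; last exact: (csummable_section (kl.2 - kl.1) csummable_corr_pairs).
    by rewrite /loc_kernel /cross_corr; ring.
  apply/funext => p /=; rewrite /T /= subKr.
  by rewrite (_ : kl.2 - (kl.1 - p) = p + (kl.2 - kl.1)) ?opprB 1?addrCA//; ring.
have skl := csummable_gsum (csummable_swap sT).
rewrite (eq_gsum TE).
rewrite (_ : (fun kl => gsum (fun m => T (m, kl))) = (fun kl : Zn n * Zn n =>
    f kl.1 * loc_kernel b g1 g2 (kl.2 - kl.1) * (h kl.2)^*)) in skl; last first.
  by apply/funext.
rewrite gsum_pair_swap// /inner csumE; apply: eq_gsum => l; rewrite num_conjE /conv.
rewrite -gsumZr; first by [].
exact: csummable_conv_term csummable_loc_kernel sf.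
Qed.

End Kernel.

Theorem mainTheorem20 (R : realType) (n : nat) (g1 g2 : Zn n -> R[i])
    (hg1 : rapidly_decreasing g1) (hg2 : rapidly_decreasing g2)
    (beta : torus R n -> R[i]) (hbeta : in_Lp +oo%E beta) :
  let varsigma : Zn n -> torus R n -> R[i] := fun m w => beta w in
  let mu : torus R n -> R[i] := fun xi =>
    cint (fun w => beta w * (fourier (modulation w g1) xi)^*
                   * fourier (modulation w g2) xi) in
  forall f h : Zn n -> R[i], in_l2 f -> in_l2 h ->
    [/\ is_localization g1 g2 varsigma f (localization g1 g2 varsigma f),
        is_multiplier mu f (multiplier mu f)
      & inner (localization g1 g2 varsigma f) h = inner (multiplier mu f) h].
Proof.
move=> varsigma mu f h hf hh.
have s1 := rapidly_decreasing_summable hg1.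
have s2 := rapidly_decreasing_summable hg2.
have ib := in_Ly_cintegrable hbeta.
have sK := csummable_loc_kernel s1 s2 ib.
have /in_l2P sf := hf.
pose u := conv (loc_kernel beta g1 g2) f.
have [su _] := young sK sf.
have lu : in_l2 u by apply/in_l2P.
have muE xi : mu xi = fourier (loc_kernel beta g1 g2) xi := symbol_fourier s1 s2 ib xi.
have Lu : is_localization g1 g2 varsigma f u.
  by split=> // h' /in_l2P sh'; rewrite (localization_form_conv s1 s2 ib sf sh').
have uF := is_fourier_l2_conv sK sf (fourier_l2_is_fourier hf).
have Mu : is_multiplier mu f u.
  split=> //; apply: filterS (fourier_l2_ae_unique (fourier_l2_is_fourier lu) uF) => xi ->.
  by rewrite muE.
have Lloc : is_localization g1 g2 varsigma f (localization g1 g2 varsigma f).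
  exact: (xgetPex (fun=> 0) (ex_intro _ u Lu)).
have Mmul : is_multiplier mu f (multiplier mu f).
  exact: (xgetPex (fun=> 0) (ex_intro _ u Mu)).
split=> //.
have [lm Mm] := Mmul; have [_ Muu] := Mu.
have -> : multiplier mu f = u.
  apply: (fourier_l2_inj (fourier_l2_is_fourier lm) (fourier_l2_is_fourier lu)).
  by apply: filterS2 Mm Muu => xi -> ->.
have [_ ->//] := Lloc; have [_ ->//] := Lu.
Qed.
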